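(* Let $P$ and $P'$ be smooth $3$-dimensional prismatoids in $\mathbb{R}^3$ which are Minkowski equivalent. Then the pair $(P, P')$ is IDP, i.e. every lattice point of $P + P'$ is the sum of a lattice point of $P$ and a lattice point of $P'$.
   Context: A lattice polytope is the convex hull of finitely many points of $\mathbb{Z}^d$. A $d$-dimensional polytope is simple if each vertex lies in exactly $d$ edges. The primitive edge directions at a vertex are the smallest lattice vectors pointing along its incident edges. A $d$-dimensional lattice polytope in $\mathbb{R}^d$ is smooth if it is simple and at every vertex the primitive edge directions form a basis of $\mathbb{Z}^d$. A $d$-dimensional prism is a polytope affinely equivalent to $Q \times [0,1]$ for some $(d-1)$-dimensional polytope $Q$; its top and bottom facets are the images of $Q\times\{1\}$ and $Q \times \{0\}$. A prismatoid is a polytope whose face lattice is isomorphic to that of a prism and such that the facets corresponding to the top and bottom facets (called its top and bottom) are parallel. Two faces $F,G$ are parallel if $\mathrm{lin}(F)=\mathrm{lin}(G)$, where $\mathrm{lin}(F)$ is the linear subspace parallel to the affine hull of $F$. Two polytopes are Minkowski equivalent if they have the same normal fan. For lattice polytopes $P,Q$, the pair $(P,Q)$ is IDP if every lattice point of $P+Q$ is the sum of a lattice point of $P$ and a lattice point of $Q$. *)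

(* Defs.v *)
From HB Require Import structures.
From mathcomp Require Import all_boot all_order all_algebra.
From mathcomp Require Import boolp classical_sets reals.
Set Implicit Arguments. Unset Strict Implicit. Unset Printing Implicit Defensive.
Import Order.TTheory GRing.Theory Num.Theory.
Local Open Scope ring_scope.
Local Open Scope classical_set_scope.

Section Polytopes.
Variable R : realType.

Definition dotv n (u v : 'rV[R]_n) : R := \sum_(i < n) u 0 i * v 0 i.

Definition integral n (x : 'rV[R]_n) : Prop := forall i, x 0 i \is a Num.int.

Definition conv n (V : seq 'rV[R]_n) : set 'rV[R]_n :=
  [set x | exists l : 'I_(size V) -> R,
     (forall i, 0 <= l i) /\ \sum_i l i = 1 /\ x = \sum_i l i *: V`_i].

Definition lattice_polytope n (V : seq 'rV[R]_n) : Prop :=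
  forall v, v \in V -> integral v.

(* faces: intersections of P with supporting hyperplanes (c = 0 gives P,
   large b gives the empty face) *)
Definition is_face n (P F : set 'rV[R]_n) : Prop :=
  exists (c : 'rV[R]_n) (b : R),
    (forall x, P x -> dotv c x <= b) /\ F = P `&` [set x | dotv c x = b].

Definition affdim_ge n (S : set 'rV[R]_n) (k : nat) : Prop :=
  exists (p0 : 'rV[R]_n) (s : seq 'rV[R]_n),
    S p0 /\ (forall x, x \in s -> S x) /\ size s = k /\
    free [seq x - p0 | x <- s].

Definition has_dim n (S : set 'rV[R]_n) (k : nat) : Prop :=
  affdim_ge S k /\ ~ affdim_ge S k.+1.

Definition is_vertex n (P : set 'rV[R]_n) (v : 'rV[R]_n) : Prop :=
  is_face P [set v].

Definition is_edge n (P E : set 'rV[R]_n) : Prop := is_face P E /\ has_dim E 1.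

(* lin(F): the linear subspace parallel to the affine hull of F *)
Definition lin n (F : set 'rV[R]_n) : set 'rV[R]_n :=
  [set v | exists (s : seq ('rV[R]_n * 'rV[R]_n)) (c : seq R),
     (forall p, p \in s -> F p.1 /\ F p.2) /\
     v = \sum_(i < size s) c`_i *: ((nth (0, 0) s i).1 - (nth (0, 0) s i).2)].

Definition parallel n (F G : set 'rV[R]_n) : Prop := lin F = lin G.

Definition points_along n (v : 'rV[R]_n) (E : set 'rV[R]_n) (u : 'rV[R]_n) :=
  integral u /\ u != 0 /\ exists t : R, 0 < t /\ E (v + t *: u).

Definition prim_dir n (v : 'rV[R]_n) (E : set 'rV[R]_n) (u : 'rV[R]_n) :=
  points_along v E u /\
  forall u', points_along v E u' -> exists r : R, 1 <= r /\ u' = r *: u.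

Definition simple3 (P : set 'rV[R]_3) : Prop :=
  forall v, is_vertex P v ->
    exists E1 E2 E3, [/\ is_edge P E1, is_edge P E2 & is_edge P E3] /\
      [/\ E1 v, E2 v & E3 v] /\ [/\ E1 <> E2, E1 <> E3 & E2 <> E3] /\
      forall E, is_edge P E -> E v -> E = E1 \/ E = E2 \/ E = E3.

Definition Zbasis3 (u1 u2 u3 : 'rV[R]_3) : Prop :=
  [/\ integral u1, integral u2, integral u3,
      free [:: u1; u2; u3] &
      forall z, integral z -> exists a1 a2 a3 : R,
        [/\ a1 \is a Num.int, a2 \is a Num.int, a3 \is a Num.int &
            z = a1 *: u1 + a2 *: u2 + a3 *: u3]].

Definition smooth3 (P : set 'rV[R]_3) : Prop :=
  simple3 P /\
  forall v, is_vertex P v ->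
    exists E1 E2 E3 u1 u2 u3,
      [/\ is_edge P E1, is_edge P E2 & is_edge P E3] /\
      [/\ E1 v, E2 v & E3 v] /\ [/\ E1 <> E2, E1 <> E3 & E2 <> E3] /\
      [/\ prim_dir v E1 u1, prim_dir v E2 u2 & prim_dir v E3 u3] /\
      Zbasis3 u1 u2 u3.

Definition embed (q : 'rV[R]_2) (t : R) : 'rV[R]_3 :=
  \row_(i < 3) (if (i < 2)%N then q 0 (inord i) else t).

Definition affmap (M : 'M[R]_3) (a : 'rV[R]_3) (x : 'rV[R]_3) : 'rV[R]_3 :=
  x *m M + a.

Definition prism_set (Q : set 'rV[R]_2) M a : set 'rV[R]_3 :=
  [set x | exists q t, Q q /\ 0 <= t <= 1 /\ x = affmap M a (embed q t)].
Definition prism_level (Q : set 'rV[R]_2) M a (t : R) : set 'rV[R]_3 :=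
  [set x | exists q, Q q /\ x = affmap M a (embed q t)].

Definition face_lattice_iso n (P P' : set 'rV[R]_n)
    (f : set 'rV[R]_n -> set 'rV[R]_n) : Prop :=
  [/\ forall F, is_face P F -> is_face P' (f F),
      forall G, is_face P' G -> exists F, is_face P F /\ f F = G &
      forall F G, is_face P F -> is_face P G -> (F `<=` G <-> f F `<=` f G)].

Definition prismatoid3 (P : set 'rV[R]_3) : Prop :=
  exists (VQ : seq 'rV[R]_2) (M : 'M[R]_3) (a : 'rV[R]_3) f,
    has_dim (conv VQ) 2 /\ M \in unitmx /\
    face_lattice_iso P (prism_set (conv VQ) M a) f /\
    exists T B, [/\ is_face P T, is_face P B,
      f T = prism_level (conv VQ) M a 1,
      f B = prism_level (conv VQ) M a 0 & parallel T B].

Definition normal_cone n (P F : set 'rV[R]_n) : set 'rV[R]_n :=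
  [set c | forall x y, F x -> P y -> dotv c y <= dotv c x].
Definition normal_fan n (P : set 'rV[R]_n) : set (set 'rV[R]_n) :=
  [set N | exists F, is_face P F /\ F !=set0 /\ N = normal_cone P F].

Definition minkowski_equiv n (P P' : set 'rV[R]_n) : Prop :=
  normal_fan P = normal_fan P'.

Definition IDP_pair n (P P' : set 'rV[R]_n) : Prop :=
  forall z, integral z -> (exists x y, P x /\ P' y /\ z = x + y) ->
    exists x y, [/\ integral x, integral y, P x, P' y & z = x + y].

End Polytopes.

(* Main.v *)
Require Import Defs.
From HB Require Import structures.
From mathcomp Require Import all_boot all_order all_algebra.
From mathcomp Require Import boolp classical_sets reals.
From mathcomp Require Import ring lra.
Set Implicit Arguments. Unset Strict Implicit. Unset Printing Implicit Defensive.
Import Order.TTheory GRing.Theory Num.Theory.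
Local Open Scope ring_scope.
Local Open Scope classical_set_scope.

(**
Let [c] be the primitive integral functional that is constant on the top and on
the bottom of [P]. For every functional [a] there is a multiple [r c] such that
the face of [P] exposed by [a + r c] meets both top and bottom, and hence
contains an edge from bottom to top; by smoothness its primitive direction [u]
satisfies [c u = 1]. As the normal fans agree, [a + r c] also exposes on [P'] a
face containing an edge of direction [u] from the lowest to the highest level.
Thus the slices of [P] and [P'] at integral heights are lattice polygons, and
[z = x + y] still decomposes when the height of [x] is rounded down and that of
[y] is rounded up. This reduces the theorem to lattice polygons [P], [Q] such
that every edge direction (with outer normal) of [Q] is one of [P].

For polygons, suppose that [P] and [z - Q] meet but share no lattice point. The
boundary of [z - Q] has an edge crossed by [P] between two adjacent lattice
points. Two boundary lines of [P] bound the crossing, and all lattice points of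
[z - Q] lie beyond one of them. Following one line through [z - Q] leads to a
second edge crossed by [P] between adjacent lattice points, bounded by the same
two lines. But [P] has edges parallel to the two crossed edges, of lattice
length at least one, on the far side; so the two lines diverge in both
directions, which is absurd.
*)

(** * Lattice points between two boundary lines *)

Section Walk.
Variable R : realType.
Implicit Types (P Q : R -> R -> Prop) (A B C x y : R).

(** That all lattice points of the second polygon lie beyond one of the two lines is proved by
    descent on the height [m] over the crossed edge. The triangle over the segment from (0,0) to
    (1,0) with apex [(k, m)] contains one lattice point [(j, 1)] of height 1. Not being in [P], it
    lies beyond one of the lines, and together with an end of the base it spans a new crossed
    segment, over which the apex is lower.

    Rounding the heights is harmless for the following reason. For each [a] a single multiple [r c]
    makes [a + r c] maximal on whole edges from bottom to top, so both polytopes have lattice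
    maximizers on every integral level. In a sum the term [r c] sees only the total height, which
    rounding preserves; hence no [a] separates [z] from the sum of the two slices.

    Polytopes are hulls of arbitrary lists, possibly with redundant points. Vertices, edges and exit
    points are therefore recovered from maximizers of functionals, with half-space descriptions
    supplied by Fourier-Motzkin elimination. The normal fan enters only as a transfer of inclusions
    between exposed faces. *)

Definition convex2 P := forall x1 x2 y1 y2 t, 0 <= t <= 1 ->
  P x1 x2 -> P y1 y2 -> P (x1 + t * (y1 - x1)) (x2 + t * (y2 - x2)).

Lemma int_gt0_ge1 (x : R) : x \is a Num.int -> 0 < x -> 1 <= x.
Proof. by move=> /intrP[n ->]; rewrite ltr0z ler1z. Qed.

Lemma int_lt_leB1 (x y : R) :
  x \is a Num.int -> y \is a Num.int -> x < y -> x <= y - 1.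
Proof.
move=> xi yi xy; have : y - x \is a Num.int by rewrite rpredB.
by move=> /int_gt0_ge1; rewrite subr_gt0 => /(_ xy); lra.
Qed.

Lemma convex2_level P A B C x1 x2 p1 p2 l : convex2 P -> P x1 x2 -> P p1 p2 ->
  A + B * x1 + C * x2 = 0 -> A + B * p1 + C * p2 = 0 ->
  x2 <= l <= p2 -> x2 < p2 -> exists2 y, P y l & A + B * y + C * l = 0.
Proof.
move=> cP Px Pp Ex Ep /andP[xl lp] xp.
pose t := (l - x2) / (p2 - x2).
have d0 : 0 < p2 - x2 by rewrite subr_gt0.
have tE : t * (p2 - x2) = l - x2 by rewrite /t divfK // gt_eqF.
exists (x1 + t * (p1 - x1)).
  have -> : l = x2 + t * (p2 - x2) by rewrite tE; ring.
  by apply: cP => //; rewrite /t ler_pdivrMr // mul1r divr_ge0 //=; lra.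
have -> : C * l = C * (x2 + t * (p2 - x2)) by rewrite tE; ring.
transitivity ((1 - t) * (A + B * x1 + C * x2) + t * (A + B * p1 + C * p2)).
  ring.
by rewrite Ex Ep; ring.
Qed.

(* A boundary line of [P] whose part in [P] covers all heights from [0] to [1],
   as it contains [x] and the lattice point [p]. *)
Record wedge P A B C x1 x2 p1 p2 : Prop := Wedge {
  wedge_le : forall x y, P x y -> A + B * x + C * y <= 0;
  wedge_memx : P x1 x2;
  wedge_memp : P p1 p2;
  wedge_x : A + B * x1 + C * x2 = 0;
  wedge_p : A + B * p1 + C * p2 = 0;
  wedge_x0 : x2 <= 0;
  wedge_p1 : 1 <= p2;
  wedge_int1 : p1 \is a Num.int;
  wedge_int2 : p2 \is a Num.int }.

Lemma wedge_level P A B C x1 x2 p1 p2 l : convex2 P ->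
  wedge P A B C x1 x2 p1 p2 -> 0 <= l <= 1 ->
  exists2 y, P y l & A + B * y + C * l = 0.
Proof.
move=> cP [_ Px Pp Ex Ep x0 p0 _ _] /andP[l0 l1].
by apply: (convex2_level cP Px Pp Ex Ep); lra.
Qed.

(** On the line, the new height interpolates between [z0 - 1 < 0] at old height 0 and [z1 - j > 0]
    at old height 1. So old heights at most 0 give new heights at most 0, and old heights at least 1
    give positive ones, hence at least 1 at lattice points. *)
Lemma wedge_step P A B C a1 a2 q1 q2 z0 z1 j : wedge P A B C a1 a2 q1 q2 ->
  B != 0 -> A + B * z0 = 0 -> A + B * z1 + C = 0 -> z0 < 1 -> j < z1 ->
  j \is a Num.int ->
  wedge (fun a h => P (j + a * (1 - j) + h) (1 - a))
    (A + B * j + C) (B * (1 - j) - C) B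
    (1 - a2) (a1 - 1 + a2 * (1 - j)) (1 - q2) (q1 - 1 + q2 * (1 - j)).
Proof.
case=> le Pa Pq Ea Eq a0 q0 qi1 qi2 B0 Ez0 Ez1 z01 jz1 ji.
have on_line u v : A + B * u + C * v = 0 ->
    u - 1 + v * (1 - j) = (1 - v) * (z0 - 1) + v * (z1 - j).
  clear -B0 Ez0 Ez1 => Euv; apply: (mulfI B0).
  transitivity ((1 - v) * (B * z0) + v * (B * z1) - B + v * B * (1 - j));
    last by ring.
  have -> : B * z0 = - A by lra.
  have -> : B * z1 = - A - C by lra.
  have -> : B * (u - 1 + v * (1 - j)) = B * u - B + v * B * (1 - j) by ring.
  have -> : B * u = - A - C * v by lra.
  by ring.
have qi : q1 - 1 + q2 * (1 - j) \is a Num.int.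
  by rewrite !(rpredB, rpredD, rpredM) ?rpred1.
have z00 : z0 - 1 < 0 by rewrite subr_lt0.
have z10 : 0 < z1 - j by rewrite subr_gt0.
split.
- by move=> x y /le; congr (_ <= _); ring.
- by move: Pa; congr P; ring.
- by move: Pq; congr P; ring.
- by rewrite -[RHS]Ea; ring.
- by rewrite -[RHS]Eq; ring.
- rewrite (on_line _ _ Ea); clear -z00 z10 a0.
  have : (1 - a2) * (z0 - 1) <= 0 by rewrite mulr_ge0_le0; lra.
  have : a2 * (z1 - j) <= 0 by rewrite mulr_le0_ge0; lra.
  by lra.
- apply: int_gt0_ge1 => //; rewrite (on_line _ _ Eq); clear -z00 z10 q0.
  have : 0 <= (1 - q2) * (z0 - 1) by rewrite mulr_le0; lra.
  have : 0 < q2 * (z1 - j) by rewrite mulr_gt0; lra.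
  by lra.
- by rewrite rpredB ?rpred1.
- by [].
Qed.

(** The signs say that the first line bounds [P] on the left with (0,0) beyond it, and the second on
    the right with (1,0) beyond it. The apex [(k, m)] is only known to lie in [Q] and on the inner
    side of both lines. Its height is a natural number to allow induction. *)
Definition no_lattice_point_between (m : nat) : Prop :=
  forall P Q A B C x1 x2 p1 p2 A' B' C' x1' x2' p1' p2' k,
  convex2 P -> convex2 Q ->
  (forall i j, i \is a Num.int -> j \is a Num.int -> P i j -> Q i j -> False) ->
  wedge P A B C x1 x2 p1 p2 -> wedge P A' B' C' x1' x2' p1' p2' ->
  Q 0 0 -> Q 1 0 -> 0 < A -> B < 0 -> 0 < B' -> 0 < A' + B' ->
  k \is a Num.int -> Q k m%:R ->
  A + B * k + C * m%:R <= 0 -> A' + B' * k + C' * m%:R <= 0 -> False.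

(* Replaces the base segment from (0,0) to (1,0) by the one from (j,1) to
   (1,0): the unimodular change of coordinates is
   (a, h) |-> (j + a (1 - j) + h, 1 - a). *)
Lemma no_lattice_point_between_step (m : nat) :
  (forall n, (n < m)%N -> no_lattice_point_between n) ->
  forall P Q A B C x1 x2 p1 p2 A' B' C' x1' x2' p1' p2' k j,
  convex2 P -> convex2 Q ->
  (forall i j, i \is a Num.int -> j \is a Num.int -> P i j -> Q i j -> False) ->
  wedge P A B C x1 x2 p1 p2 -> wedge P A' B' C' x1' x2' p1' p2' ->
  Q 1 0 -> 0 < A -> B < 0 -> 0 < B' -> 0 < A' + B' ->
  k \is a Num.int -> Q k m%:R ->
  A + B * k + C * m%:R <= 0 -> A' + B' * k + C' * m%:R <= 0 ->
  j \is a Num.int -> k <= m%:R * j <= k + m%:R - 1 -> Q j 1 ->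
  0 < A + B * j + C -> False.
Proof.
move=> IH P Q A B C x1 x2 p1 p2 A' B' C' x1' x2' p1' p2' k j cP cQ PQ w w'.
move=> Q10 A0 B0 B0' AB0' ki Qk Ek Ek' ji /andP[kj jk] Qj Ej.
have le01 : 0 <= (0 : R) <= 1 by lra.
have le11 : 0 <= (1 : R) <= 1 by lra.
have [x0 Px0 Ex0] := wedge_level cP w le01.
have [x0' Px0' Ex0'] := wedge_level cP w' le01.
have [y0 Py0 Ey0] := wedge_level cP w le11.
have [y0' Py0' Ey0'] := wedge_level cP w' le11.
have Ex01 : A + B * x0 = 0 by clear -Ex0; lra.
have Ex01' : A' + B' * x0' = 0 by clear -Ex0'; lra.
have Ey01 : A + B * y0 + C = 0 by clear -Ey0; lra.
have Ey01' : A' + B' * y0' + C' = 0 by clear -Ey0'; lra.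
have x0x0' : x0 <= x0'.
  by rewrite -(ler_pM2l B0'); have := wedge_le w' Px0; lra.
have y0y0' : y0 <= y0'.
  by rewrite -(ler_pM2l B0'); have := wedge_le w' Py0; lra.
have x0'1 : x0' < 1 by rewrite -(ltr_pM2l B0'); lra.
have x01 : x0 < 1 by exact: le_lt_trans x0x0' x0'1.
have jy0 : j < y0 by rewrite -(ltr_nM2l B0); lra.
pose F (S : R -> R -> Prop) a h := S (j + a * (1 - j) + h) (1 - a).
have cF S : convex2 S -> convex2 (F S).
  move=> cS a1 a2 b1 b2 t t01 Sa Sb; rewrite /F.
  have := cS _ _ _ _ _ t01 Sa Sb.
  by congr S; ring.
have FP (S : R -> R -> Prop) a h : S a h -> F S (1 - h) (a - 1 + h * (1 - j)).
  by rewrite /F; congr S; ring.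
(* Height of the apex over the new base; the two bounds on [m%:R * j] amount to
   [0 <= m1 <= m - 1]. *)
pose m1 : R := k - 1 + m%:R * (1 - j).
have m1i : m1 \is a Num.int.
  by rewrite /m1 !(rpredB, rpredD, rpredM) ?rpred1 ?rpred_nat.
have m10 : 0 <= m1 by rewrite /m1; lra.
move: (m1i); rewrite (intrEge0 m10) => /natrP[n nE].
have nm : (n < m)%N.
  by rewrite -(ltr_nat R) -nE /m1; lra.
apply: (IH n nm (F P) (F Q) _ _ _ _ _ _ _ _ _ _ _ _ _ _ (1 - m%:R)
  (cF _ cP) (cF _ cQ) _
  (wedge_step w (negbT (lt_eqF B0)) Ex01 Ey01 x01 jy0 ji)
  (wedge_step w' (negbT (gt_eqF B0')) Ex01' Ey01' x0'1 (lt_le_trans jy0 y0y0') ji)).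
- move=> a h ai hi; apply: PQ.
    by rewrite !(rpredB, rpredD, rpredM) ?rpred1.
  by rewrite rpredB ?rpred1.
- by rewrite /F; move: Qj; congr Q; ring.
- by rewrite /F; move: Q10; congr Q; ring.
- by [].
- by rewrite -(ltr_nM2l B0) in x01; clear -x01 Ej Ex01; lra.
- have : B' * j < B' * y0' by rewrite ltr_pM2l // (lt_le_trans jy0).
  by clear -Ey01' AB0'; lra.
- by clear -AB0'; lra.
- by rewrite rpredB ?rpred1 ?rpred_nat.
- by rewrite -nE; exact: FP.
- by rewrite -nE /m1; move: Ek; congr (_ <= _); ring.
- by rewrite -nE /m1; move: Ek'; congr (_ <= _); ring.
Qed.

(** Exactly one of the [m] consecutive integers from [k] to [k + m - 1] is a multiple of [m], say
    [m * j]; this places [(j, 1)] in the triangle spanned by the base and the apex. If [(j, 1)] is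
    beyond neither line, it lies between two points of [P] at height 1 and so in both sets. *)
Lemma no_lattice_point_betweenP m : no_lattice_point_between m.
Proof.
elim/ltn_ind: m => m IH P Q A B C x1 x2 p1 p2 A' B' C' x1' x2' p1' p2' k.
move=> cP cQ PQ w w' Q00 Q10 A0 B0 B0' AB0' ki Qk Ek Ek'.
have [m0|m0] := posnP m.
  have k0 : 0 < k by move: Ek; rewrite m0; nra.
  by have := int_gt0_ge1 ki k0; move: Ek'; rewrite m0; nra.
have mR : 0 < m%:R :> R by rewrite ltr0n.
pose j : R := (Num.floor ((k + m%:R - 1) / m%:R))%:~R.
have ji : j \is a Num.int by rewrite intr_int.
have j1 : m%:R * j <= k + m%:R - 1.
  by rewrite mulrC -ler_pdivlMr // /j floor_le_tmp.
have j2 : k <= m%:R * j.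
  have : k - 1 < m%:R * j.
    have : k + m%:R - 1 < (j + 1) * m%:R.
      by rewrite -ltr_pdivrMr // /j -[1]/(1%:~R) -intrD floorD1_gt.
    by lra.
  by move=> /int_lt_leB1; rewrite !(rpredB, rpredM) ?rpred1 ?rpred_nat //; lra.
have Qj : Q j 1.
  have [m1|m1] := eqVneq m 1%N.
    have -> : j = k by move: j1 j2; rewrite m1; lra.
    by move: Qk; rewrite m1.
  have m1R : 0 < m%:R - 1 :> R by rewrite subr_gt0 ltr1n ltn_neqAle eq_sym m1.
  (* [(b, 0)] is the point of the base whose segment to the apex passes through [(j, 1)]. *)
  pose b := (m%:R * j - k) / (m%:R - 1).
  have bE : b * (m%:R - 1) = m%:R * j - k by rewrite divfK // gt_eqF.
  have b01 : 0 <= b <= 1.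
    rewrite /b ler_pdivrMr // divr_ge0 ?subr_ge0 ?(ltW m1R) //=.
      by clear -j1; lra.
    by rewrite ler1n.
  have := cQ _ _ _ _ _ b01 Q00 Q10.
  have m01 : 0 <= (m%:R^-1 : R) <= 1.
    by rewrite invr_ge0 ltW //= invf_le1 // ler1n.
  move=> Qb; have := cQ _ _ _ _ _ m01 Qb Qk.
  have mV : m%:R^-1 * m%:R = 1 :> R by rewrite mulVf // gt_eqF.
  congr Q; last by rewrite -[RHS]mV; ring.
  apply: (mulfI (negbT (gt_eqF mR))).
  transitivity (m%:R * b + m%:R^-1 * m%:R * (k - b)); first by ring.
  have -> : m%:R * j = b * (m%:R - 1) + k by rewrite bE; ring.
  by rewrite mV; ring.
have le11 : 0 <= (1 : R) <= 1 by rewrite ler01 lexx.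
have [y0 Py0 Ey0] := wedge_level cP w le11.
have [y0' Py0' Ey0'] := wedge_level cP w' le11.
have [Ej|Ej] := ltP 0 (A + B * j + C).
  apply: (no_lattice_point_between_step IH cP cQ PQ w w' Q10 A0 B0 B0' AB0'
    ki Qk Ek Ek' ji _ Qj Ej).
  by rewrite j1 j2.
have [Ej'|Ej'] := ltP 0 (A' + B' * j + C').
  (* Reflection exchanging the ends of the base: the right line becomes the left one. *)
  pose F (S : R -> R -> Prop) a h := S (1 - a) h.
  have cF S : convex2 S -> convex2 (F S).
    move=> cS a1 a2 b1 b2 t t01 Sa Sb; rewrite /F.
    by have := cS _ _ _ _ _ t01 Sa Sb; congr S; ring.
  have wF D1 D2 D3 a1 a2 q1 q2 : wedge P D1 D2 D3 a1 a2 q1 q2 ->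
      wedge (F P) (D1 + D2) (- D2) D3 (1 - a1) a2 (1 - q1) q2.
    clear=> -[le Pa Pq Ea Eq a0 q0 qi1 qi2]; split=> //.
    - by move=> x y /le; congr (_ <= _); ring.
    - by move: Pa; rewrite /F; congr P; ring.
    - by move: Pq; rewrite /F; congr P; ring.
    - by rewrite -[RHS]Ea; ring.
    - by rewrite -[RHS]Eq; ring.
    - by rewrite rpredB ?rpred1.
  apply: (no_lattice_point_between_step IH (cF _ cP) (cF _ cQ) _ (wF _ _ _ _ _ _ _ w')
    (wF _ _ _ _ _ _ _ w) _ AB0' _ _ _ (k := 1 - k) (j := 1 - j)).
  - by move=> a h ai hi; apply: PQ; rewrite ?rpredB ?rpred1.
  - by move: Q00; rewrite /F; congr Q; ring.
  - by rewrite oppr_lt0.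
  - by rewrite oppr_gt0.
  - by clear -A0; lra.
  - by rewrite rpredB ?rpred1.
  - by move: Qk; rewrite /F; congr Q; ring.
  - by move: Ek'; congr (_ <= _); ring.
  - by move: Ek; congr (_ <= _); ring.
  - by rewrite rpredB ?rpred1.
  - by apply/andP; split; clear -j1 j2; lra.
  - by move: Qj; rewrite /F; congr Q; ring.
  - by move: Ej'; congr (_ < _); ring.
apply: (PQ j 1) => //.
have y0j : y0 <= j by rewrite -(ler_nM2l B0); clear -Ej Ey0; lra.
have jy0' : j <= y0' by rewrite -(ler_pM2l B0'); clear -Ej' Ey0'; lra.
have [yy|yy] := eqVneq y0 y0'.
  by have -> : j = y0 by apply/eqP; rewrite eq_le y0j yy jy0'.
have d0 : 0 < y0' - y0 by rewrite subr_gt0 lt_neqAle yy (le_trans y0j).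
have t01 : 0 <= (j - y0) / (y0' - y0) <= 1.
  rewrite ler_pdivrMr // divr_ge0 ?subr_ge0 //= ?(le_trans y0j) //.
  by clear -jy0'; lra.
have := cP _ _ _ _ _ t01 Py0 Py0'.
by rewrite divfK ?gt_eqF //; congr P; ring.
Qed.
End Walk.

(** * Convex hulls and the theorem of Weyl *)

Section Conv.
Variables (R : realType) (n : nat).
Implicit Types (u v x y : 'rV[R]_n) (V W : seq 'rV[R]_n).

Lemma dotvC u v : dotv u v = dotv v u.
Proof. by apply: eq_bigr => i _; rewrite mulrC. Qed.

Lemma dotvDr u x y : dotv u (x + y) = dotv u x + dotv u y.
Proof. by rewrite /dotv -big_split; apply: eq_bigr => i _; rewrite mxE mulrDr. Qed.

Lemma dotvZr u l x : dotv u (l *: x) = l * dotv u x.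
Proof. by rewrite /dotv mulr_sumr; apply: eq_bigr => i _; rewrite mxE mulrCA. Qed.

Lemma dotvNr u x : dotv u (- x) = - dotv u x.
Proof. by rewrite -scaleN1r dotvZr mulN1r. Qed.

Lemma dotvBr u x y : dotv u (x - y) = dotv u x - dotv u y.
Proof. by rewrite dotvDr dotvNr. Qed.

Lemma dotv0r u : dotv u 0 = 0.
Proof. by rewrite -(scale0r 0) dotvZr mul0r. Qed.

Lemma dotvDl u v x : dotv (u + v) x = dotv u x + dotv v x.
Proof. by rewrite dotvC dotvDr !(dotvC x). Qed.

Lemma dotvZl l u x : dotv (l *: u) x = l * dotv u x.
Proof. by rewrite dotvC dotvZr dotvC. Qed.

Lemma dotvNl u x : dotv (- u) x = - dotv u x.
Proof. by rewrite dotvC dotvNr dotvC. Qed.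

Lemma dotvBl u v x : dotv (u - v) x = dotv u x - dotv v x.
Proof. by rewrite dotvDl dotvNl. Qed.

Lemma dotv0l x : dotv 0 x = 0.
Proof. by rewrite dotvC dotv0r. Qed.

Lemma dotv_delta i x : dotv (delta_mx 0 i) x = x 0 i.
Proof.
rewrite /dotv (bigD1 i) //= mxE !eqxx mul1r big1 ?addr0 // => j ji.
by rewrite mxE (negbTE ji) andbF mul0r.
Qed.

Lemma dotv_ge0 x : 0 <= dotv x x.
Proof. by apply: sumr_ge0 => i _; rewrite -expr2 sqr_ge0. Qed.

Lemma dotv_eq0 x : dotv x x = 0 -> x = 0.
Proof.
move=> x0; apply/rowP => i; rewrite mxE; apply/eqP; rewrite -sqrf_eq0 expr2.
have /psumr_eq0P := x0 => -> // j _.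
by rewrite -expr2 sqr_ge0.
Qed.

Definition dotvE := (dotvDr, dotvDl, dotvNr, dotvNl, dotvZr, dotvZl, dotv0r, dotv0l).

(** The cone generated by the vectors [(v, 1)]. Homogenizing removes the normalization of the
    weights, so that generators can be eliminated one by one. *)
Fixpoint lifted_cone V x (t : R) : Prop :=
  if V is v :: V' then exists2 l, 0 <= l & lifted_cone V' (x - l *: v) (t - l)
  else x = 0 /\ t = 0.

Lemma lifted_coneP V x t : lifted_cone V x t <->
  exists l : 'I_(size V) -> R,
    (forall i, 0 <= l i) /\ \sum_i l i = t /\ x = \sum_i l i *: V`_i.
Proof.
elim: V x t => [|v V IH] x t /=.
  split=> [[-> ->]|[l [_ [<- ->]]]]; last by rewrite !big_ord0.
  by exists (fun=> 0); rewrite !big_ord0; split => // -[].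
split=> [[l0 l0_ge0 /IH[l [l_ge0 [lt lx]]]]|[l [l_ge0 [lt lx]]]].
  exists (fun i => oapp l l0 (unlift ord0 i)); split.
    by move=> i; case: unliftP => [j|] _ /=.
  rewrite !big_ord_recl /= unlift_none /=; split.
    rewrite (eq_bigr l) => [|i _]; first by rewrite lt addrC subrK.
    by rewrite liftK.
  rewrite (eq_bigr (fun i => l i *: V`_i)).
    by rewrite -lx addrC subrK.
  by move=> i _; rewrite liftK.
exists (l ord0) => //; apply/IH; exists (fun i => l (lift ord0 i)).
split=> [i|] //; move: lt lx; rewrite !big_ord_recl /= => <- ->.
by split; rewrite addrAC subrr add0r.
Qed.

Lemma conv_cone V x : conv V x <-> lifted_cone V x 1.
Proof. exact: iff_sym (lifted_coneP V x 1). Qed.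

(** Constraints with [0 < e p] bound [l] below, those with [e q < 0] bound it above. The greatest of
    0 and the lower bounds works: the second hypothesis, divided by [e p * e q], compares each lower
    bound with each upper one. *)
Lemma fourier_motzkin1 (T : eqType) (L : seq T) (c e : T -> R) :
  (forall p, p \in L -> e p <= 0 -> c p <= 0) ->
  (forall p q, p \in L -> q \in L -> 0 < e p -> e q < 0 ->
     e p * c q <= e q * c p) ->
  exists2 l, 0 <= l & forall p, p \in L -> c p <= l * e p.
Proof.
move=> c_le0 c_le.
have [l l0 [lP lE]] : exists2 l, 0 <= l &
    (forall p, p \in L -> 0 < e p -> c p <= l * e p) /\
    (l = 0 \/ exists2 p, p \in L & 0 < e p /\ c p = l * e p).
  elim: L {c_le0 c_le} => [|p L [l l0 [lP lE]]]; first by exists 0 => //; split; [|left].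
  have lE' : l = 0 \/ exists2 p0, p0 \in p :: L & 0 < e p0 /\ c p0 = l * e p0.
    case: lE => [|[q qL ?]]; [by left|right].
    by exists q => //; rewrite inE qL orbT.
  have [/andP[ep cp]|] := boolP ((0 < e p) && (l * e p < c p)).
    have lcp : l < c p / e p by rewrite ltr_pdivlMr.
    exists (c p / e p); first exact: le_trans l0 (ltW lcp).
    split; last by right; exists p; rewrite ?inE ?eqxx // divfK ?gt_eqF.
    move=> q; rewrite inE => /predU1P[->|qL] eq0; first by rewrite divfK ?gt_eqF.
    by apply: le_trans (lP _ qL eq0) _; rewrite ler_pM2r // ltW.
  rewrite negb_and -!leNgt => epP; exists l => //; split=> // q.
  rewrite inE => /predU1P[->|/lP//] ep; case/orP: epP => //.
  by rewrite leNgt ep.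
exists l => // q qL; have [eq0|] := ltP 0 (e q); first exact: lP.
rewrite le_eqVlt => /predU1P[eq0|eq0].
  by rewrite eq0 mulr0 c_le0 // eq0.
case: lE => [->|[p pL [ep cp]]]; first by rewrite mul0r c_le0 // ltW.
have := c_le _ _ pL qL ep eq0; rewrite cp.
by rewrite mulrA (mulrC _ (e p)) ler_pM2l // mulrC.
Qed.

(** A new generator adds one nonnegative unknown, its weight. Eliminating it keeps the constraints
    that are nonpositive on the generator and adds, for each pair of opposite signs, the combination
    [comb] that vanishes on it. *)
Lemma weyl V : exists A : seq ('rV[R]_n * R), forall x t,
  lifted_cone V x t <-> forall p, p \in A -> dotv p.1 x + p.2 * t <= 0.
Proof.
elim: V => [|v V [A AP]] /=.
  exists ([:: (0, 1); (0, -1)] ++ [seq (s *: delta_mx 0 i, 0) | s <- [:: 1; -1],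
    i <- enum 'I_n]) => x t; split.
    by case=> -> -> p _; rewrite dotv0r mulr0 addr0.
  move=> h; have t0 : t = 0.
    have := h (0, 1); have := h (0, -1); rewrite !inE !eqxx ?orbT /= !dotv0l.
    by move=> /(_ isT) h1 /(_ isT) h2; lra.
  split=> //; apply/rowP => i; rewrite mxE.
  have hs s : s \in [:: 1; -1] -> s * x 0 i <= 0.
    move=> sI; have := h (s *: delta_mx 0 i, 0).
    rewrite mem_cat allpairs_f ?mem_enum ?orbT // => /(_ isT) /=.
    by rewrite dotvZl dotv_delta mul0r addr0.
  have := hs 1; have := hs (-1); rewrite !inE !eqxx ?orbT.
  by move=> /(_ isT) h1 /(_ isT) h2; lra.
pose e p := dotv p.1 v + p.2 : R.
pose comb (p q : 'rV[R]_n * R) := (e p *: q.1 - e q *: p.1, e p * q.2 - e q * p.2).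
exists ([seq p <- A | e p <= 0] ++
  [seq comb p q | p <- [seq p <- A | 0 < e p], q <- [seq q <- A | e q < 0]]).
move=> x t.
have evE p l : dotv p.1 (x - l *: v) + p.2 * (t - l) =
    dotv p.1 x + p.2 * t - l * e p.
  by rewrite !dotvE /e; ring.
split=> [[l l0 /AP lP] p|h].
  rewrite mem_cat => /orP[|/allpairsP[[q r] /=]].
    rewrite mem_filter => /andP[ep /lP]; rewrite evE.
    by have := mulr_ge0_le0 l0 ep; lra.
  rewrite !mem_filter => -[/andP[eq /lP hq] /andP[er /lP hr] -> /=].
  move: hq hr.
  rewrite !evE !subr_le0 => hq hr.
  rewrite !dotvE; apply: (@le_trans _ _
    (e q * (l * e r) - e r * (l * e q))); last by rewrite subr_le0; lra.
  have : e q * (dotv r.1 x + r.2 * t) <= e q * (l * e r) by rewrite ler_pM2l.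
  have : e r * (l * e q) <= e r * (dotv q.1 x + q.2 * t) by rewrite ler_nM2l.
  by lra.
have [||l l0 lP] := @fourier_motzkin1 _ A (fun p => dotv p.1 x + p.2 * t) e.
- by move=> p pA ep; apply: h; rewrite mem_cat mem_filter ep pA.
- move=> p q pA qA ep eq.
  have := h (comb p q); rewrite mem_cat allpairs_f ?mem_filter ?ep ?eq ?orbT //.
  by move=> /(_ isT) /=; rewrite !dotvE; lra.
- by exists l => //; apply/AP => p /lP; rewrite evE subr_le0.
Qed.

Lemma conv_hrep V : exists A : seq ('rV[R]_n * R), forall x,
  conv V x <-> forall p, p \in A -> dotv p.1 x <= p.2.
Proof.
have [A AP] := weyl V; exists [seq (p.1, - p.2) | p <- A] => x.
rewrite conv_cone AP; split=> h p.
  by move=> /mapP[q /h + ->] /=; lra.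
by move=> pA; have := h _ (map_f _ pA) => /=; lra.
Qed.

Lemma conv_convex V x y t : 0 <= t <= 1 -> conv V x -> conv V y ->
  conv V (x + t *: (y - x)).
Proof.
have [A AP] := conv_hrep V => /andP[t0 t1] /AP hx /AP hy; apply/AP => p pA.
have t1' : 0 <= 1 - t by rewrite subr_ge0.
have := ler_wpM2l t0 (hy _ pA); have := ler_wpM2l t1' (hx _ pA).
by rewrite !dotvE; lra.
Qed.

Lemma lifted_cone0 V : lifted_cone V 0 0.
Proof. by elim: V => //= v V IH; exists 0 => //; rewrite scale0r !subr0. Qed.

Lemma conv_mem V v : v \in V -> conv V v.
Proof.
move=> vV; apply/conv_cone; elim: V vV => //= w V IH.
rewrite inE => /predU1P[->|/IH vV].
  by exists 1; rewrite // scale1r !subrr; exact: lifted_cone0.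
by exists 0; rewrite // scale0r !subr0.
Qed.

Lemma conv_min V (C : set 'rV[R]_n) :
  (forall x y t, 0 <= t <= 1 -> C x -> C y -> C (x + t *: (y - x))) ->
  (forall v, v \in V -> C v) -> conv V `<=` C.
Proof.
move=> cC VC x /conv_cone.
suff H t : lifted_cone V x t -> (t = 0 /\ x = 0) \/ (0 < t /\ C (t^-1 *: x)).
  move=> /H[[/eqP]|[_]]; first by rewrite oner_eq0.
  by rewrite invr1 scale1r.
elim: V VC x t => [|v V IH] VC x t /=; first by case=> -> ->; left.
case=> l l0 /IH[w wV|[tl xl]|[tl xl]]; first by apply: VC; rewrite inE wV orbT.
  have -> : x = l *: v by apply/eqP; rewrite -subr_eq0 xl.
  have -> : t = l by apply/eqP; rewrite -subr_eq0 tl.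
  move: l0; rewrite le_eqVlt => /predU1P[<-|l0]; first by rewrite scale0r; left.
  by right; rewrite scalerA mulVf ?gt_eqF // scale1r; split=> //; apply/VC/mem_head.
have t0 : 0 < t by lra.
right; split=> //.
have lt01 : 0 <= l / t <= 1.
  by rewrite ler_pdivrMr // mul1r divr_ge0 ?(ltW t0) //=; lra.
have := cC _ _ _ lt01 xl (VC v (mem_head _ _)); congr C.
set y := (t - l)^-1 *: _.
have yE : (t - l) *: y = x - l *: v by rewrite /y scalerA divff ?gt_eqF // scale1r.
clearbody y.
apply: (@scalerI _ _ t); first by rewrite gt_eqF.
rewrite scalerA divff ?gt_eqF // scale1r scalerDr scalerA mulrCA divff ?gt_eqF //.
by rewrite mulr1 scalerBr addrCA -scalerBl yE addrC subrK.
Qed.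

(** A weight [l] on [v] costs the slack [l * (m - dotv a v)], which is nonnegative. Without total
    slack, only generators attaining [m] carry weight. *)
Lemma lifted_cone_tight V (a : 'rV[R]_n) (m : R) x t :
  (forall v, v \in V -> dotv a v <= m) -> lifted_cone V x t ->
  dotv a x <= m * t /\
  (dotv a x = m * t -> lifted_cone [seq v <- V | dotv a v == m] x t).
Proof.
elim: V x t => [|v V IH] x t Vm /=.
  by case=> -> ->; rewrite dotv0r mulr0.
case=> l l0 /IH[w wV|le tight]; first by apply: Vm; rewrite inE wV orbT.
have vm := ler_wpM2l l0 (Vm v (mem_head _ _)).
move: le tight; rewrite !dotvE => le tight; split; first by lra.
move=> E; have /tight {}tight : dotv a x + - (l * dotv a v) = m * (t - l) by lra.
case: ifP => [_|/negbT vNm]; first by exists l.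
have lE : l * (dotv a v - m) = 0 by lra.
move/eqP: lE; rewrite mulf_eq0 subr_eq0 (negbTE vNm) orbF => /eqP l_eq0.
by move: tight; rewrite l_eq0 scale0r !subr0.
Qed.

Lemma conv_le V (a : 'rV[R]_n) m x :
  (forall v, v \in V -> dotv a v <= m) -> conv V x -> dotv a x <= m.
Proof. by move=> Vm /conv_cone/(lifted_cone_tight Vm)[]; rewrite mulr1. Qed.

Lemma conv_tight V (a : 'rV[R]_n) m x :
  (forall v, v \in V -> dotv a v <= m) -> conv V x -> dotv a x = m ->
  conv [seq v <- V | dotv a v == m] x.
Proof.
move=> Vm /conv_cone/(lifted_cone_tight Vm)[_]; rewrite mulr1 => h /h.
by move/conv_cone.
Qed.

Lemma conv_nil x : ~ conv [::] x.
Proof. by case/conv_cone => _ /eqP; rewrite oner_eq0. Qed.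

Lemma conv_separation V x : ~ conv V x ->
  exists a : 'rV[R]_n, forall v, v \in V -> dotv a v < dotv a x.
Proof.
have [A AP] := conv_hrep V => xV.
have [p pA px] : exists2 p, p \in A & p.2 < dotv p.1 x.
  apply: contrapT => h; apply: xV; apply/AP => p pA.
  by rewrite leNgt; apply/negP => px; apply: h; exists p.
exists p.1 => v /conv_mem/AP/(_ p pA) pv.
exact: le_lt_trans pv px.
Qed.

(** In the half-space description the segment stops at the first constraint to be violated, and the
    normal of that constraint is [a]. The induction over the constraints keeps the earliest stopping
    parameter; [s] is that of the head constraint. *)
Lemma conv_exit V k q : conv V k -> ~ conv V q ->
  exists (a : 'rV[R]_n) (t : R), 0 <= t < 1 /\ conv V (k + t *: (q - k)) /\
    (forall v, v \in V -> dotv a v <= dotv a (k + t *: (q - k))) /\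
    dotv a (k + t *: (q - k)) < dotv a q.
Proof.
have [A AP] := conv_hrep V => /AP hk qV.
have {qV} hq : ~ forall p, p \in A -> dotv p.1 q <= p.2 by move=> h; apply/qV/AP.
suff [p pA [t [/andP[t0 t1] [tx [pq pt]]]]] : exists2 p, p \in A & exists t,
    0 <= t < 1 /\ (forall p, p \in A -> dotv p.1 (k + t *: (q - k)) <= p.2) /\
    p.2 < dotv p.1 q /\ dotv p.1 (k + t *: (q - k)) = p.2.
  exists p.1, t; split; first by rewrite t0 t1.
  split; first by apply/AP.
  rewrite pt; split=> //.
  by move=> v /conv_mem/AP/(_ p pA).
elim: A hk hq {AP} => [|p A IH] hk hq; first by case: hq.
have {}hkA p' : p' \in A -> dotv p'.1 k <= p'.2.
  by move=> p'A; apply: hk; rewrite inE p'A orbT.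
have {hk} hkp : dotv p.1 k <= p.2 by apply/hk/mem_head.
have pE t : dotv p.1 (k + t *: (q - k)) =
  dotv p.1 k + t * (dotv p.1 q - dotv p.1 k) by rewrite !dotvE; ring.
pose s := (p.2 - dotv p.1 k) / (dotv p.1 q - dotv p.1 k).
have s01 : p.2 < dotv p.1 q -> 0 <= s < 1.
  move=> pq; have d0 : 0 < dotv p.1 q - dotv p.1 k by lra.
  by rewrite /s ltr_pdivrMr // divr_ge0 ?(ltW d0) //=; lra.
have sE : p.2 < dotv p.1 q -> dotv p.1 (k + s *: (q - k)) = p.2.
  by move=> pq; rewrite pE divfK ?subrKC // subr_eq0 gt_eqF //; lra.
have [hqA|hqA] := EM (forall p, p \in A -> dotv p.1 q <= p.2).
  have pq : p.2 < dotv p.1 q.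
    rewrite ltNge; apply/negP => pq; apply: hq => p'.
    by rewrite inE => /predU1P[->|/hqA].
  exists p; first exact: mem_head.
  exists s; rewrite sE //; split; [exact: s01|split=> //].
  move=> p'; rewrite inE => /predU1P[->|p'A]; first by rewrite sE.
  have := hkA _ p'A; have := hqA _ p'A; have /andP[s0 s1] := s01 pq.
  by rewrite !dotvE; nra.
have [p' p'A [t [t01 [tA [p'q p't]]]]] := IH hkA hqA.
have [pt|pt] := leP (dotv p.1 (k + t *: (q - k))) p.2.
  exists p'; first by rewrite inE p'A orbT.
  exists t; split=> //; split=> // p''.
  by rewrite inE => /predU1P[->|/tA].
have pq : p.2 < dotv p.1 q.
  by move: pt t01; rewrite pE => pt /andP[t0 t1]; nra.
have st : s <= t.
  rewrite /s ler_pdivrMr; last by lra.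
  by move: pt; rewrite pE; lra.
exists p; first exact: mem_head.
exists s; rewrite sE //; split; [exact: s01|split=> //].
move=> p''; rewrite inE => /predU1P[->|p''A]; first by rewrite sE.
have := hkA _ p''A; have := tA _ p''A; have /andP[s0 s1] := s01 pq.
rewrite !dotvE; set d := _ - _ => tA' kA'.
have [d0|d0] := leP d 0.
  by have := mulr_ge0_le0 s0 d0; lra.
by have : s * d <= t * d; [rewrite ler_pM2r | lra].
Qed.

End Conv.

(** * Lattice edges in the plane *)

Section Core.
Variable R : realType.
Implicit Types (P Q : R -> R -> Prop).

Definition int2 (x y : R) := x \is a Num.int /\ y \is a Num.int.

(* The hypotheses say that the line through the origin along [d], on whose
   positive side [u] lies, separates [u] from the apex of the cone cut out by
   [e <= 0] and [e' <= 0]; so on the ray [f] of its boundary [e = 0] the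
   direction away from the line is the one entering the cone. *)
Lemma cone_ray_direction (a1 a2 e1 e2 g1 g2 d1 d2 u1 u2 f1 f2 : R) :
  a1 * d1 + a2 * d2 = 0 -> e1 * d1 + e2 * d2 < 0 -> 0 < g1 * d1 + g2 * d2 ->
  e1 * u1 + e2 * u2 < 0 -> g1 * u1 + g2 * u2 < 0 -> 0 <= a1 * u1 + a2 * u2 ->
  e1 * f1 + e2 * f2 = 0 -> 0 < a1 * f1 + a2 * f2 -> g1 * f1 + g2 * f2 < 0.
Proof.
set ad := a1 * d1 + _; set ed := e1 * d1 + _; set gd := g1 * d1 + _.
set eu := e1 * u1 + _; set gu := g1 * u1 + _; set au := a1 * u1 + _.
set ef := e1 * f1 + _; set af := a1 * f1 + _; set gf := g1 * f1 + _.
move=> ad0 ed0 gd0 eu0 gu0 au0 ef0 af0; rewrite ltNge; apply/negP => gf0.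
(* A combination of [e] and [g] with positive coefficients that vanishes on [d], hence is
   proportional to [a]. Its values on [u] and [f] therefore compare as those of [a], which is [E];
   the sign of the value on [u] is known. *)
pose w1 := gd * e1 - ed * g1; pose w2 := gd * e2 - ed * g2.
have wd : w1 * d1 + w2 * d2 = 0 by rewrite /w1 /w2 /gd /ed; ring.
have aw : a1 * w2 - a2 * w1 = 0.
  have h1 : d1 * (a1 * w2 - a2 * w1) = 0.
    transitivity (w2 * ad - a2 * (w1 * d1 + w2 * d2)); first by rewrite /ad; ring.
    by rewrite ad0 wd; ring.
  have h2 : d2 * (a1 * w2 - a2 * w1) = 0.
    transitivity (a1 * (w1 * d1 + w2 * d2) - w1 * ad); first by rewrite /ad; ring.
    by rewrite ad0 wd; ring.
  move/eqP: h1; move/eqP: h2; rewrite !mulf_eq0.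
  have [//|_ /=] := eqVneq (a1 * w2 - a2 * w1) 0; rewrite !orbF.
  by move=> /eqP d20 /eqP d10; move: ed0; rewrite /ed d10 d20 !mulr0 addr0 ltxx.
have E : af * (gd * eu - ed * gu) = au * (gd * ef - ed * gf).
  apply/eqP; rewrite -subr_eq0; apply/eqP.
  transitivity ((a1 * w2 - a2 * w1) * (f1 * u2 - f2 * u1)).
    by rewrite /w1 /w2 /af /eu /gu /au /ef /gf; ring.
  by rewrite aw mul0r.
have lt0 : af * (gd * eu - ed * gu) < 0.
  rewrite pmulr_rlt0 // subr_lt0; apply: (@lt_trans _ _ 0).
    by rewrite pmulr_rlt0.
  by rewrite nmulr_rgt0.
have : 0 <= au * (gd * ef - ed * gf).
  by rewrite mulr_ge0 // ef0 mulr0 sub0r oppr_ge0 nmulr_rle0.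
by rewrite -E leNgt lt0.
Qed.

Lemma bezout_real (m n : R) : m \is a Num.int -> n \is a Num.int ->
  (m != 0) || (n != 0) -> exists g d1 d2 w1 w2 : R,
  [/\ 1 <= g, g \is a Num.int, int2 d1 d2, int2 w1 w2 &
    [/\ m = g * d1, n = g * d2 & d1 * w2 - d2 * w1 = 1]].
Proof.
move=> /intrP[m' ->] /intrP[n' ->]; rewrite !intr_eq0 => mn0.
have g0 : gcdz m' n' != 0 by rewrite gcdz_eq0 negb_and.
have [u [v uv]] := Bezoutz m' n'.
have /dvdzP[d1 d1E] := dvdz_gcdl m' n'; have /dvdzP[d2 d2E] := dvdz_gcdr m' n'.
exists (gcdz m' n')%:~R, d1%:~R, d2%:~R, (- v)%:~R, u%:~R.
rewrite /int2 !intr_int; split=> //.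
  by rewrite ler1z; move: g0; rewrite /gcdz; case: gcdn.
split; rewrite -?intrM; [by rewrite mulrC -d1E|by rewrite mulrC -d2E|].
rewrite -intrB -[RHS]/(1%:~R); congr (_ %:~R); apply: (mulIf g0).
by rewrite mul1r -[RHS]uv [in X in u * X]d1E [in X in v * X]d2E; ring.
Qed.

(** The segment is [g] times a primitive vector [d], and the point sits at position [s * g] along
    it. This position is not an integer because the point is not a lattice point, so its floor and
    the next integer give the two neighbours. The vector [w] completes [d] to a lattice basis. *)
Lemma adjacent_lattice_points (e1 e2 f1 f2 s x1 x2 : R) :
  int2 e1 e2 -> int2 f1 f2 -> 0 < s < 1 ->
  x1 = e1 + s * (f1 - e1) -> x2 = e2 + s * (f2 - e2) -> ~ int2 x1 x2 ->
  exists (r1 r2 d1 d2 w1 w2 t a b : R),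
  [/\ int2 r1 r2, int2 d1 d2, int2 w1 w2 & d1 * w2 - d2 * w1 = 1] /\
  [/\ 0 < t < 1, x1 = r1 + t * d1 & x2 = r2 + t * d2] /\
  [/\ 0 <= a <= 1, r1 = e1 + a * (f1 - e1) & r2 = e2 + a * (f2 - e2)] /\
  [/\ 0 <= b <= 1, r1 + d1 = e1 + b * (f1 - e1) & r2 + d2 = e2 + b * (f2 - e2)].
Proof.
move=> [e1i e2i] [f1i f2i] /andP[s0 s1] x1E x2E xi.
have fe1 : f1 - e1 \is a Num.int by rewrite rpredB.
have fe2 : f2 - e2 \is a Num.int by rewrite rpredB.
have fe0 : (f1 - e1 != 0) || (f2 - e2 != 0).
  rewrite -negb_and; apply/negP => /andP[/eqP fe1' /eqP fe2']; apply: xi.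
  by rewrite x1E x2E fe1' fe2' !mulr0 !addr0.
have [g [d1 [d2 [w1 [w2 [g1 gi di wi [d1E d2E dw]]]]]]] := bezout_real fe1 fe2 fe0.
have g0 : 0 < g by apply: lt_le_trans g1.
pose j : R := (Num.floor (s * g))%:~R.
have ji : j \is a Num.int by rewrite intr_int.
have jle : j <= s * g by rewrite /j floor_le_tmp.
have jgt : s * g < j + 1 by rewrite /j -[1]/(1%:~R) -intrD floorD1_gt.
have j0 : 0 <= j by rewrite /j ler0z floor_ge0 mulr_ge0 ?ltW.
have j1 : j + 1 <= g.
  have := int_lt_leB1 ji gi; have : s * g < 1 * g by rewrite ltr_pM2r.
  by move=> sg /(_ _) h; have := h (le_lt_trans jle _); rewrite -lerBrDr; apply; lra.
have gE c : c / g * g = c by rewrite divfK ?gt_eqF.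
have rE (e f d c : R) : f - e = g * d -> e + c / g * (f - e) = e + c * d.
  by move=> ->; rewrite mulrA gE.
exists (e1 + j * d1), (e2 + j * d2), d1, d2, w1, w2, (s * g - j), (j / g).
exists ((j + 1) / g); case: di => d1i d2i.
split; first by split=> //; split; rewrite rpredD ?rpredM.
split; [split|split; split].
- rewrite subr_gt0 lt_neqAle jle andbT; apply/andP; split; last by lra.
  apply/eqP => jE; apply: xi; rewrite x1E x2E d1E d2E !mulrA -jE.
  by split; rewrite rpredD ?rpredM.
- by rewrite x1E d1E; ring.
- by rewrite x2E d2E; ring.
- by rewrite divr_ge0 ?(ltW g0) //= ler_pdivrMr //; lra.
- by rewrite (rE _ _ d1).
- by rewrite (rE _ _ d2).
- by rewrite divr_ge0 ?(ltW g0) ?addr_ge0 //= ler_pdivrMr //; lra.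
- by rewrite (rE _ _ d1) //; ring.
- by rewrite (rE _ _ d2) //; ring.
Qed.

(* A line segment leaving [P] does so through a supporting line, which is an
   edge with lattice end points unless it leaves [P] at a lattice point. *)
Definition lattice_edges P := forall k1 k2 q1 q2, P k1 k2 -> ~ P q1 q2 ->
  exists A B C t x1 x2,
  [/\ 0 <= t < 1, x1 = k1 + t * (q1 - k1) & x2 = k2 + t * (q2 - k2)] /\
  [/\ P x1 x2, forall x y, P x y -> A + B * x + C * y <= 0,
      A + B * x1 + C * x2 = 0 & 0 < A + B * q1 + C * q2] /\
  (~ int2 x1 x2 -> exists e1 e2 f1 f2 s,
     [/\ int2 e1 e2, int2 f1 f2, P e1 e2 & P f1 f2] /\
     [/\ A + B * e1 + C * e2 = 0, A + B * f1 + C * f2 = 0 &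
         [/\ 0 < s < 1, x1 = e1 + s * (f1 - e1) & x2 = e2 + s * (f2 - e2)]]).

(** Maximum on [Q] is paired with minimum on [P] because [Q] stands for a reflected polygon
    [z - Q]. *)
Definition edge_refines P Q := forall B C,
  (exists v1 v2 w1 w2, [/\ int2 v1 v2, int2 w1 w2, Q v1 v2, Q w1 w2 &
    (v1, v2) <> (w1, w2)] /\ forall x y, Q x y ->
      B * x + C * y <= B * v1 + C * v2 /\ B * x + C * y <= B * w1 + C * w2) ->
  exists v1 v2 w1 w2, [/\ int2 v1 v2, int2 w1 w2, P v1 v2, P w1 w2 &
    (v1, v2) <> (w1, w2)] /\ forall x y, P x y ->
      B * v1 + C * v2 <= B * x + C * y /\ B * w1 + C * w2 <= B * x + C * y.

(** Going from [k] towards the lattice point [q] leaves [P] strictly between 0 and 1, hence inside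
    an edge with lattice ends. The line of this edge meets height 0 only at the non-integral [x1],
    so neither end has height 0 and one of them has positive height. *)
Lemma base_wedge P k q : lattice_edges P -> P k 0 -> ~ P q 0 -> 0 < k < 1 ->
  q = 0 \/ q = 1 -> exists A B C x1 p1 p2,
  [/\ wedge P A B C x1 0 p1 p2, 0 < A + B * q, 0 < x1 < 1 & A + B * x1 = 0].
Proof.
move=> eP Pk Pq /andP[k0 k1] q01.
have [A [B [C [t [x1 [x2 [[/andP[t0 t1] x1E x2E] [[Px le Ex Eq] edge]]]]]]]] :=
  eP _ _ _ _ Pk Pq.
have {}x2E : x2 = 0 by rewrite x2E subrr mulr0 addr0.
subst x2.
have x01 : 0 < x1 < 1.
  have t1' : 0 < 1 - t by rewrite subr_gt0.
  case: q01 => q01; rewrite x1E q01.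
    have -> : k + t * (0 - k) = (1 - t) * k by ring.
    rewrite mulr_gt0 //=; apply: le_lt_trans k1.
    by rewrite ler_piMl ?(ltW k0) // gerBl.
  have -> : k + t * (1 - k) = 1 - (1 - t) * (1 - k) by ring.
  have k1' : 0 < 1 - k by rewrite subr_gt0.
  rewrite gtrBl mulr_gt0 // andbT subr_gt0.
  apply: (@le_lt_trans _ _ (1 - k)); last by rewrite gtrBl.
  by rewrite ler_piMl ?(ltW k1') // gerBl.
have xNi : x1 \isn't a Num.int.
  apply/negP => xi; case/andP: x01 => x0 x1'.
  by have := int_gt0_ge1 xi x0; rewrite leNgt x1'.
have Ex1 : A + B * x1 = 0 by rewrite -[RHS]Ex; ring.
have B0 : B != 0.
  by apply/eqP => B0; move: Eq Ex; rewrite B0 !mul0r; lra.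
have nz a1 a2 : int2 a1 a2 -> A + B * a1 + C * a2 = 0 -> a2 != 0.
  move=> [a1i a2i] Ea; apply/eqP => a20; move/negP: xNi; apply.
  suff -> : x1 = a1 by [].
  by apply: (mulfI B0); move: Ea; rewrite a20 mulr0; lra.
have [|e1 [e2 [f1 [f2 [s [[ei fi Pe Pf] [Ee Ef [/andP[s0 s1] _ x2E]]]]]]]] := edge.
  by case=> xi _; rewrite xi in xNi.
have e20 := nz _ _ ei Ee; have f20 := nz _ _ fi Ef.
have [p1 [p2 [pi Pp Ep p0]]] : exists p1 p2, [/\ int2 p1 p2, P p1 p2,
    A + B * p1 + C * p2 = 0 & 0 < p2].
  have [e2p|e2n] := ltP 0 e2; first by exists e1, e2.
  exists f1, f2; split=> //.
  rewrite ltNge; apply/negP => f2n.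
  have {}e2n : e2 < 0 by rewrite lt_neqAle e20.
  have : (1 - s) * e2 < 0 by rewrite pmulr_rlt0 // subr_gt0.
  have : s * f2 <= 0 by rewrite pmulr_rle0.
  by move: x2E; lra.
exists A, B, C, x1, p1, p2; split=> //; last by move: Eq; rewrite mulr0 addr0.
by case: pi => p1i p2i; split=> //; exact: int_gt0_ge1.
Qed.

End Core.

(** * Crossings of two lattice polygons *)

Section CoreBase.
Variable R : realType.
Implicit Types (P Q : R -> R -> Prop).

(** Both vectors span the kernel of [a], so they are proportional; the factor is the determinant of
    [u] and [w], an integer. *)
Lemma lattice_multiple_of_primitive (d1 d2 w1 w2 u1 u2 a1 a2 : R) :
  d1 * w2 - d2 * w1 = 1 -> int2 w1 w2 -> int2 u1 u2 ->
  a1 * d1 + a2 * d2 = 0 -> (a1 != 0) || (a2 != 0) -> a1 * u1 + a2 * u2 = 0 ->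
  exists2 n, n \is a Num.int & u1 = n * d1 /\ u2 = n * d2.
Proof.
move=> dw [w1i w2i] [u1i u2i] ad a0 au.
have du : d1 * u2 - d2 * u1 = 0.
  have h1 : a1 * (d1 * u2 - d2 * u1) = 0.
    transitivity (u2 * (a1 * d1 + a2 * d2) - d2 * (a1 * u1 + a2 * u2)); first by ring.
    by rewrite ad au !mulr0 subr0.
  have h2 : a2 * (d1 * u2 - d2 * u1) = 0.
    transitivity (d1 * (a1 * u1 + a2 * u2) - u1 * (a1 * d1 + a2 * d2)); first by ring.
    by rewrite ad au !mulr0 subr0.
  move: a0; case/orP => a0; first exact: (mulfI a0 (etrans h1 (esym (mulr0 _)))).
  exact: (mulfI a0 (etrans h2 (esym (mulr0 _)))).
exists (u1 * w2 - u2 * w1); first by rewrite rpredB ?rpredM.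
split.
  transitivity (u1 * (d1 * w2 - d2 * w1)); first by rewrite dw mulr1.
  transitivity (u1 * (d1 * w2 - d2 * w1) - w1 * (d1 * u2 - d2 * u1)); last by ring.
  by rewrite du; ring.
transitivity (u2 * (d1 * w2 - d2 * w1)); first by rewrite dw mulr1.
transitivity (u2 * (d1 * w2 - d2 * w1) - w2 * (d1 * u2 - d2 * u1)); last by ring.
by rewrite du mulr0 subr0.
Qed.

(* Follow the left boundary line of [P] through the edge from (0,0) to (1,0)
   until it leaves [Q] through a second edge. At both edges [P] is less than one
   lattice length wide, whereas its own edges parallel to them, on the side of
   [Q], are longer; so its boundary lines would diverge in both directions. *)
Lemma no_crossing P Q k : convex2 P -> convex2 Q ->
  lattice_edges P -> lattice_edges Q -> edge_refines P Q ->
  (forall i j, i \is a Num.int -> j \is a Num.int -> P i j -> Q i j -> False) ->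
  (forall x y, Q x y -> 0 <= y) -> Q 0 0 -> Q 1 0 -> P k 0 -> 0 < k < 1 -> False.
Proof.
move=> cP cQ eP eQ ref PQ Q0 Q00 Q10 Pk k01.
have i0 : (0 : R) \is a Num.int by rewrite rpred0.
have i1 : (1 : R) \is a Num.int by rewrite rpred1.
have P00 : ~ P 0 0 by move=> h; exact: (PQ 0 0).
have P10 : ~ P 1 0 by move=> h; exact: (PQ 1 0).
have [A [B [C [x1 [p1 [p2 [w A0 x01 Ex]]]]]]] :=
  base_wedge eP Pk P00 k01 (or_introl (erefl _)).
have [A' [B' [C' [x1' [p1' [p2' [w' A0' x01' Ex']]]]]]] :=
  base_wedge eP Pk P10 k01 (or_intror (erefl _)).
rewrite mulr0 addr0 in A0; rewrite mulr1 in A0'.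
have B0 : B < 0 by case/andP: x01 => x0 _; rewrite -(pmulr_llt0 _ x0); lra.
have B0' : 0 < B'.
  case/andP: x01' => _; rewrite -subr_gt0 => x1'0.
  by rewrite -(pmulr_lgt0 _ x1'0); lra.
have Qx : Q x1 0.
  have := cQ _ _ _ _ x1 _ Q00 Q10; rewrite (_ : 0 <= x1 <= 1); last first.
    by case/andP: x01 => /ltW -> /ltW ->.
  by move=> /(_ isT); congr Q; ring.
have [le Px Pp _ Ep _ p21 p1i p2i] := w.
have [le' _ _ _ _ _ _ _ _] := w'.
have Qp : ~ Q p1 p2 by move=> h; exact: (PQ p1 p2).
(* The lattice point [(p1, p2)] of [P] is not in [Q], so the walk along the left line towards it
   leaves [Q] through a second edge, at a point of both sets. *)
have [A2 [B2 [C2 [t [k1 [k2 [[/andP[t0 t1] k1E k2E] [[Qk le2 Ek Eq] edge]]]]]]]] :=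
  eQ _ _ _ _ Qx Qp.
have t01 : 0 <= t <= 1 by rewrite t0 ltW.
have Pk' : P k1 k2 by rewrite k1E k2E; exact: cP.
have kNi : ~ int2 k1 k2 by move=> [k1i k2i]; exact: (PQ k1 k2).
have [e1 [e2 [f1 [f2 [s [[ei fi Qe Qf] [Ee Ef [s01 k1s k2s]]]]]]]] := edge kNi.
pose g1 := p1 - x1; pose g2 := p2.
have eg : B * g1 + C * g2 = 0 by rewrite /g1 /g2; clear -Ep Ex; lra.
have ng : 0 < B2 * g1 + C2 * g2.
  have t1' : 0 < 1 - t by rewrite subr_gt0.
  rewrite -(pmulr_rgt0 _ t1').
  suff -> : (1 - t) * (B2 * g1 + C2 * g2) =
      (A2 + B2 * p1 + C2 * p2) - (A2 + B2 * k1 + C2 * k2) by rewrite Ek subr0.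
  by rewrite k1E k2E /g1 /g2; ring.
have [r1 [r2 [d1 [d2 [v1 [v2 [c [a [b [[ri di vi dv] [[c01 k1c k2c]
  [[a01 r1a r2a] [b01 r1b r2b]]]]]]]]]]]]] :=
  adjacent_lattice_points ei fi s01 k1s k2s kNi.
have Qr : Q r1 r2 by rewrite r1a r2a; exact: cQ.
have Qrd : Q (r1 + d1) (r2 + d2) by rewrite r1b r2b; exact: cQ.
have Er : A2 + B2 * r1 + C2 * r2 = 0.
  rewrite r1a r2a.
  transitivity ((1 - a) * (A2 + B2 * e1 + C2 * e2) + a * (A2 + B2 * f1 + C2 * f2)).
    by ring.
  by rewrite Ee Ef; ring.
have nd : B2 * d1 + C2 * d2 = 0.
  have Erd : A2 + B2 * (r1 + d1) + C2 * (r2 + d2) = 0.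
    rewrite r1b r2b.
    transitivity ((1 - b) * (A2 + B2 * e1 + C2 * e2) + b * (A2 + B2 * f1 + C2 * f2)).
      by ring.
    by rewrite Ee Ef; ring.
  by clear -Erd Er; lra.
have Ekk : A + B * k1 + C * k2 = 0.
  rewrite k1E k2E.
  transitivity ((1 - t) * (A + B * x1) + t * (A + B * p1 + C * p2)); first by ring.
  by rewrite Ex Ep; ring.
(* The second edge is transverse to the left line: its functional vanishes on [d] but is positive on
   the direction [g] of that line. *)
have ed : B * d1 + C * d2 != 0.
  apply/eqP => ed.
  have dg : d1 * g2 - d2 * g1 = 0.
    apply: (mulfI (negbT (lt_eqF B0))).
    transitivity (g2 * (B * d1 + C * d2) - d2 * (B * g1 + C * g2)); first by ring.
    by rewrite ed eg; ring.
  have d10 : d1 = 0.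
    apply: (mulIf (negbT (gt_eqF ng))).
    transitivity (g1 * (B2 * d1 + C2 * d2) + C2 * (d1 * g2 - d2 * g1)); first by ring.
    by rewrite nd dg; ring.
  have d20 : d2 = 0.
    apply: (mulIf (negbT (gt_eqF ng))).
    transitivity (g2 * (B2 * d1 + C2 * d2) - B2 * (d1 * g2 - d2 * g1)); first by ring.
    by rewrite nd dg; ring.
  by move: dv; rewrite d10 d20 !mul0r subr0 => /eqP; rewrite eq_sym oner_eq0.
clear e1 e2 f1 f2 s ei fi Qe Qf Ee Ef s01 k1s k2s a b a01 b01 r1a r1b r2a r2b edge.
(* Orient the second edge so that, as on the base, its start is beyond the left line. *)
have {r1 r2 d1 d2 v1 v2 c ri di vi dv c01 k1c k2c Qr Qrd Er nd ed}
  [r1 [r2 [d1 [d2 [v1 [v2 [c [[ri di vi dv] [c01 k1c k2c] [Qr Qrd Er nd] ed]]]]]]]] :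
  exists r1 r2 d1 d2 v1 v2 c,
  [/\ [/\ int2 r1 r2, int2 d1 d2, int2 v1 v2 & d1 * v2 - d2 * v1 = 1],
    [/\ 0 < c < 1, k1 = r1 + c * d1 & k2 = r2 + c * d2],
    [/\ Q r1 r2, Q (r1 + d1) (r2 + d2), A2 + B2 * r1 + C2 * r2 = 0 &
      B2 * d1 + C2 * d2 = 0] & B * d1 + C * d2 < 0].
  move: ed; rewrite neq_lt => /orP[ed|ed]; first by exists r1, r2, d1, d2, v1, v2, c.
  case: ri di vi => r1i r2i [d1i d2i] [v1i v2i].
  exists (r1 + d1), (r2 + d2), (- d1), (- d2), (- v1), (- v2), (1 - c); split.
  - by split; rewrite /int2 ?rpredN ?rpredD //; rewrite -dv; ring.
  - split; [by case/andP: c01 => c0 c1; apply/andP; split; lra|..].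
      by rewrite k1c; ring.
    by rewrite k2c; ring.
  - by split=> //; [rewrite !addrK|clear -Er nd; lra|clear -nd; lra].
  - by clear -ed; lra.
have [c0 c1] := andP c01.
have Er0 : 0 < A + B * r1 + C * r2.
  have : 0 < - c * (B * d1 + C * d2) by rewrite nmulr_rgt0 // oppr_lt0.
  by move: Ekk; rewrite k1c k2c; clear; lra.
have Erd0 : A + B * (r1 + d1) + C * (r2 + d2) < 0.
  have c1' : 0 < 1 - c by rewrite subr_gt0.
  have : (1 - c) * (B * d1 + C * d2) < 0 by rewrite pmulr_rlt0.
  by move: Ekk; rewrite k1c k2c; clear; lra.
(* The other end satisfies the left inequality, so the descent puts it beyond the right line. *)
have Erd0' : 0 < A' + B' * (r1 + d1) + C' * (r2 + d2).
  rewrite ltNge; apply/negP => Erd'.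
  have [rd1i rd2i] : int2 (r1 + d1) (r2 + d2).
    by case: ri di => ? ? [? ?]; split; rewrite rpredD.
  have rd0 := Q0 _ _ Qrd.
  move: rd2i; rewrite (intrEge0 rd0) => /natrP[m mE].
  rewrite mE in Erd' Erd0 Qrd.
  exact: (no_lattice_point_betweenP cP cQ PQ w w' Q00 Q10 A0 B0 B0' A0' rd1i Qrd
    (ltW Erd0) Erd').
have ed' : 0 < B' * d1 + C' * d2.
  have c1' : 0 < 1 - c by rewrite subr_gt0.
  rewrite -(pmulr_rgt0 _ c1').
  by have := le' _ _ Pk'; move: Erd0'; rewrite k1c k2c; clear; lra.
(* The top edge of [P] is horizontal, of height at least 0 and length at least 1, while [P] is
   narrower than 1 at height 0. So the left line moves away from the right one when followed
   upwards. *)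
have down : B' * g1 + C' * g2 < 0.
  have [|u1 [u2 [v1' [v2' [[[ui1 ui2] [vi1' vi2'] Pu Pv uv] uvP]]]]] := ref 0 (-1).
    exists 0, 0, 1, 0; split.
      by split=> //; case=> /eqP; rewrite eq_sym oner_eq0.
    by move=> x y /Q0; lra.
  have u2v2 : u2 = v2'.
    have [_] := uvP _ _ Pu; have [+ _] := uvP _ _ Pv; clear; lra.
  have u20 : 0 <= u2.
    by have [+ _] := uvP _ _ Pk; clear; lra.
  clear uvP; subst v2'.
  have {uv}[u1' [u1'' [ui ui' Pu' Pu'' uu]]] : exists u u', [/\ u \is a Num.int,
      u' \is a Num.int, P u u2, P u' u2 & u + 1 <= u'].
    have : u1 != v1' by apply/eqP => h; apply: uv; rewrite h.
    rewrite neq_lt => /orP[] h; [exists u1, v1'|exists v1', u1]; split=> //.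
      by have := int_lt_leB1 ui1 vi1' h; clear; lra.
    by have := int_lt_leB1 vi1' ui1 h; clear; lra.
  apply: (@cone_ray_direction _ 0 1 B C B' C' 1 0 u1' u2 g1 g2) => //.
  - by clear; lra.
  - by move: B0; clear; lra.
  - by move: B0'; clear; lra.
  - by have := le _ _ Pu'; move: A0; clear; lra.
  - have : B' * (u1' + 1) <= B' * u1'' by rewrite ler_pM2l.
    by have := le' _ _ Pu''; move: A0'; clear; lra.
  - by move: u20; clear; lra.
  - by rewrite /g2; move: p21; clear; lra.
(* The same comparison at the second edge, against the parallel edge of [P] on the side of [Q],
   makes the lines diverge downwards as well. *)
have : B' * - g1 + C' * - g2 < 0; last by move: down; clear; lra.
have [|u1 [u2 [v1' [v2' [[[ui1 ui2] [vi1' vi2'] Pu Pv uv] uvP]]]]] := ref B2 C2.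
  exists r1, r2, (r1 + d1), (r2 + d2); split.
    split=> //; first by case: ri di => ? ? [? ?]; split; rewrite rpredD.
    move=> [h1 h2]; have d10 : d1 = 0 by clear -h1; lra.
    have d20 : d2 = 0 by clear -h2; lra.
    by move: dv; rewrite d10 d20 !mul0r subr0 => /eqP; rewrite eq_sym oner_eq0.
  by move=> x y /le2; move: Er nd; clear; lra.
have nuv : B2 * (v1' - u1) + C2 * (v2' - u2) = 0.
  have [_] := uvP _ _ Pu; have [+ _] := uvP _ _ Pv; clear; lra.
have uvi : int2 (v1' - u1) (v2' - u2) by split; rewrite rpredB.
have n0 : (B2 != 0) || (C2 != 0).
  rewrite -negb_and; apply/negP => /andP[/eqP b0 /eqP c0'].
  by move: ng; rewrite b0 c0' !mul0r addr0 ltxx.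
have [m mi [m1 m2]] := lattice_multiple_of_primitive dv vi uvi nd n0 nuv.
(* The edge of [P] is [m * d] with [m] a nonzero integer, so it contains a translate of [d]; the
   sign of [m] tells at which end to start. *)
have [z1 [z2 [Pz Pzd zP]]] : exists z1 z2, [/\ P z1 z2, P (z1 + d1) (z2 + d2) &
    forall x y, P x y -> B2 * z1 + C2 * z2 <= B2 * x + C2 * y].
  have m0 : m != 0.
    apply/eqP => m0; apply: uv; rewrite m0 !mul0r in m1 m2.
    by rewrite -(subrK u1 v1') -(subrK u2 v2') m1 m2 !add0r.
  have mV : m * m^-1 = 1 by rewrite divff.
  move: (m0); rewrite neq_lt => /orP[mn|mp].
    exists v1', v2'; split=> //; last by move=> x y /uvP[].
    have m01 : 0 <= - m^-1 <= 1.
      have m1' : 1 <= - m by apply: int_gt0_ge1; rewrite ?rpredN ?oppr_gt0.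
      rewrite -invrN invr_ge0 oppr_ge0 (ltW mn) /= invf_le1 //.
      by rewrite oppr_gt0.
    have := cP _ _ _ _ _ m01 Pv Pu.
    rewrite -(opprB v1' u1) -(opprB v2' u2) m1 m2.
    by congr P; rewrite mulrNN mulrA (mulrC _ m) mV mul1r.
  exists u1, u2; split=> //; last by move=> x y /uvP[].
  have m01 : 0 <= m^-1 <= 1.
    by rewrite invr_ge0 (ltW mp) /= invf_le1 // int_gt0_ge1.
  have := cP _ _ _ _ _ m01 Pu Pv.
  by rewrite m1 m2; congr P; rewrite mulrA (mulrC _ m) mV mul1r.
apply: (@cone_ray_direction _ (- B2) (- C2) B C B' C' d1 d2 (z1 - r1) (z2 - r2)) => //.
- by move: nd; clear; lra.
- by have := le _ _ Pz; move: Er0; clear; lra.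
- by have := le' _ _ Pzd; move: Erd0'; clear; lra.
- by have := zP _ _ Pk'; move: Ek Er; clear; lra.
- by move: eg; clear; lra.
- by move: ng; clear; lra.
Qed.

End CoreBase.

(** * Affine images, sums and maximizers of convex hulls *)

Section ConvMore.
Variables (R : realType) (n m : nat).
Implicit Types (V W : seq 'rV[R]_n).

Lemma conv_map (g : 'rV[R]_n -> 'rV[R]_m) V x :
  (forall x y t, g (x + t *: (y - x)) = g x + t *: (g y - g x)) ->
  conv V x -> conv (map g V) (g x).
Proof.
move=> gA; move: x; apply: conv_min => [x y t t01 Vx Vy|v vV].
  by rewrite gA; exact: conv_convex.
by apply: conv_mem; exact: map_f.
Qed.

Lemma conv_map_inv (g : 'rV[R]_n -> 'rV[R]_m) V y :
  (forall x y t, g (x + t *: (y - x)) = g x + t *: (g y - g x)) ->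
  conv (map g V) y -> exists2 x, conv V x & y = g x.
Proof.
move=> gA; move: y.
apply: (@conv_min _ _ _ [set y | exists2 x, conv V x & y = g x]).
  move=> x y t t01 [x' Vx ->] [y' Vy ->].
  by exists (x' + t *: (y' - x')); rewrite ?gA //; exact: conv_convex.
by move=> y /mapP[x xV ->]; exists x => //; exact: conv_mem.
Qed.

Lemma conv_sum_inv V W x : conv [seq u + v | u <- V, v <- W] x ->
  exists y z, [/\ conv V y, conv W z & x = y + z].
Proof.
move: x; apply: (@conv_min _ _ _
  [set x | exists y z, [/\ conv V y, conv W z & x = y + z]]).
  move=> x y t t01 [x1 [x2 [Vx1 Wx2 ->]]] [y1 [y2 [Vy1 Wy2 ->]]].
  exists (x1 + t *: (y1 - x1)), (x2 + t *: (y2 - x2)); split.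
  - exact: conv_convex.
  - exact: conv_convex.
  - by rewrite addrACA -scalerDr opprD addrACA.
move=> x /allpairsP[[u v] [/= uV vW ->]].
by exists u, v; split=> //; exact: conv_mem.
Qed.

Lemma conv_nonempty V x : conv V x -> exists v, v \in V.
Proof.
case: V => [|v V] Vx; first by case: (conv_nil Vx).
by exists v; rewrite mem_head.
Qed.

Definition maximizer (a : 'rV[R]_n) V v :=
  v \in V /\ forall w, w \in V -> dotv a w <= dotv a v.

(** The points maximizing [a] are in the hull of the maximizing generators; if these all coincided,
    the hull would be one point. *)
Lemma two_maximizers V (a x y : 'rV[R]_n) : conv V x -> conv V y -> x <> y ->
  (forall v, v \in V -> dotv a v <= dotv a x) ->
  (forall v, v \in V -> dotv a v <= dotv a y) ->
  exists v w, [/\ maximizer a V v, maximizer a V w & v <> w].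
Proof.
move=> Vx Vy xy ax ay.
have axy : dotv a x = dotv a y.
  by apply/eqP; rewrite eq_le (conv_le ay Vx) (conv_le ax Vy).
have Tx := conv_tight ax Vx erefl.
have Ty := conv_tight ax Vy (esym axy).
set T := [seq v <- V | _] in Tx Ty.
have TM v : v \in T -> maximizer a V v.
  by rewrite mem_filter => /andP[/eqP av vV]; split=> // w /ax; rewrite av.
have [v vT] := conv_nonempty Tx.
suff [w wT vw] : exists2 w, w \in T & v <> w by exists v, w; split=> //; exact: TM.
apply: contrapT => h; have {}h w : w \in T -> w = v.
  by move=> wT; apply: contrapT => wv; apply: h; exists w => // /esym.
have pt (u : 'rV[R]_n) : conv T u -> u = v.
  move: u; apply: (@conv_min _ _ _ [set u | u = v]) => // u u' t _ -> ->.
  by rewrite subrr scaler0 addr0.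
by apply: xy; rewrite (pt _ Tx) (pt _ Ty).
Qed.

(** For nonzero [a] in the plane: each outer edge normal of [conv W] is one of [conv V]. *)
Definition two_maximizers_refine V W := forall a : 'rV[R]_n,
  (exists v w, [/\ maximizer a W v, maximizer a W w & v <> w]) ->
  exists v w, [/\ maximizer a V v, maximizer a V w & v <> w].

End ConvMore.

(** * Edges of polygons in the plane *)

Section Plane.
Variable R : realType.
Implicit Types (W : seq 'rV[R]_2) (a u v : 'rV[R]_2).

Definition pt (x y : R) : 'rV[R]_2 := \row_i (if i == 0 then x else y).

Lemma pt0 x y : pt x y 0 0 = x. Proof. by rewrite mxE. Qed.
Lemma pt1 x y : pt x y 0 1 = y. Proof. by rewrite mxE. Qed.

Lemma ptE u : u = pt (u 0 0) (u 0 1).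
Proof.
apply/rowP => i; rewrite mxE; case: eqVneq => [->//|i0].
by congr (u 0 _); apply/val_inj; case: i i0 => [[|[]]].
Qed.

Lemma eq_pt u v : u 0 0 = v 0 0 -> u 0 1 = v 0 1 -> u = v.
Proof. by move=> u0 u1; rewrite (ptE u) (ptE v) u0 u1. Qed.

Lemma dotv2 a u : dotv a u = a 0 0 * u 0 0 + a 0 1 * u 0 1.
Proof.
rewrite /dotv big_ord_recl big_ord1; congr (_ + a 0 _ * u 0 _);
by apply/val_inj.
Qed.

Lemma integral2 u : integral u <-> int2 (u 0 0) (u 0 1).
Proof.
split=> [ui|[u0 u1] i]; first by split.
by rewrite (ptE u) mxE; case: ifP.
Qed.

(** The functional [b], which is [a] turned by a right angle, separates the points of the supporting
    line. If no tight generator lay on one side of [x], the generators extremal for [b] on that line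
    would equal [x]. *)
Lemma tight_segment W a x : conv W x -> (forall v, v \in W -> dotv a v <= dotv a x) ->
  a <> 0 -> x \notin W -> exists e f s, [/\ e \in W, f \in W, 0 < s < 1 &
    [/\ dotv a e = dotv a x, dotv a f = dotv a x & x = e + s *: (f - e)]].
Proof.
move=> Wx ax a0 xW; have Tx := conv_tight ax Wx erefl.
set T := [seq v <- W | _] in Tx.
pose b := pt (- a 0 1) (a 0 0).
have aa0 : a 0 0 ^+ 2 + a 0 1 ^+ 2 != 0.
  rewrite paddr_eq0 ?sqr_ge0 // !sqrf_eq0; apply/negP => /andP[/eqP h0 /eqP h1].
  by apply: a0; apply: eq_pt; rewrite mxE.
have bE u : dotv b u = a 0 0 * u 0 1 - a 0 1 * u 0 0.
  by rewrite dotv2 pt0 pt1; ring.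
have ab u v : dotv a u = dotv a v -> dotv b u = dotv b v -> u = v.
  rewrite !bE !dotv2 => h1 h2; apply: eq_pt; apply: (mulfI aa0).
    transitivity (a 0 0 * (a 0 0 * u 0 0 + a 0 1 * u 0 1)
      - a 0 1 * (a 0 0 * u 0 1 - a 0 1 * u 0 0)); first by ring.
    by rewrite h1 h2; ring.
  transitivity (a 0 1 * (a 0 0 * u 0 0 + a 0 1 * u 0 1)
    + a 0 0 * (a 0 0 * u 0 1 - a 0 1 * u 0 0)); first by ring.
  by rewrite h1 h2; ring.
have side (c : 'rV[R]_2) : c = b \/ c = - b ->
    exists2 v, v \in T & dotv c v < dotv c x.
  move=> cb; apply: contrapT => h.
  have {}h v : v \in T -> dotv (- c) v <= dotv (- c) x.
    move=> vT; rewrite !dotvNl lerN2 leNgt; apply/negP => lt.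
    by apply: h; exists v.
  have [v] := conv_nonempty (conv_tight h Tx erefl).
  rewrite !mem_filter => /andP[/eqP cv /andP[/eqP av vW]].
  move/negP: xW; apply; suff -> : x = v by [].
  apply/esym/ab => //.
  by case: cb cv => ->; rewrite ?opprK // !dotvNl => /oppr_inj.
have [e eT ex] := side b (or_introl erefl).
have [f fT] := side (- b) (or_intror erefl); rewrite !dotvNl ltrN2 => fx.
move: eT fT; rewrite !mem_filter => /andP[/eqP ae eW] /andP[/eqP af fW].
have d0 : 0 < dotv b f - dotv b e by rewrite subr_gt0 (lt_trans ex).
exists e, f, ((dotv b x - dotv b e) / (dotv b f - dotv b e)); split=> //.
  apply/andP; split; first by rewrite divr_gt0 // subr_gt0.
  by rewrite ltr_pdivrMr // mul1r ltrD2r.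
split=> //; apply: ab; rewrite !dotvE; first by rewrite ae af subrr mulr0 addr0.
by rewrite divfK ?gt_eqF // subrKC.
Qed.

End Plane.

(** * Unimodular affine coordinates in the plane *)

Section Frame.
Variables (R : realType) (r1 r2 d1 d2 w1 w2 o : R).
Hypotheses (ri : int2 r1 r2) (di : int2 d1 d2) (wi : int2 w1 w2).
Hypotheses (oi : o \is a Num.int) (dw : o * (d1 * w2 - d2 * w1) = 1).
Implicit Types (W : seq 'rV[R]_2) (c u : 'rV[R]_2).

(** The integer [o] is the determinant of the axes, 1 or -1; both signs are allowed so that the
    second axis can be turned towards the inside of a polygon. *)
Definition frame (x y : R) : 'rV[R]_2 := pt (r1 + x * d1 + y * w1) (r2 + x * d2 + y * w2).

Lemma frameA x1 x2 y1 y2 t : frame (x1 + t * (y1 - x1)) (x2 + t * (y2 - x2)) =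
  frame x1 x2 + t *: (frame y1 y2 - frame x1 x2).
Proof. by apply: eq_pt; rewrite !mxE /=; ring. Qed.

Lemma frame_dotv c x y : dotv c (frame x y) =
  dotv c (pt r1 r2) + x * dotv c (pt d1 d2) + y * dotv c (pt w1 w2).
Proof. by rewrite !dotv2 !pt0 !pt1; ring. Qed.

Definition coord1 u := o * ((u 0 0 - r1) * w2 - (u 0 1 - r2) * w1).
Definition coord2 u := o * (d1 * (u 0 1 - r2) - d2 * (u 0 0 - r1)).

Lemma frameK u : frame (coord1 u) (coord2 u) = u.
Proof.
apply: eq_pt; rewrite ?pt0 ?pt1 /coord1 /coord2.
  transitivity (r1 + o * (d1 * w2 - d2 * w1) * (u 0 0 - r1)); first by ring.
  by rewrite dw; ring.
transitivity (r2 + o * (d1 * w2 - d2 * w1) * (u 0 1 - r2)); first by ring.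
by rewrite dw; ring.
Qed.

Lemma coord1K x y : coord1 (frame x y) = x.
Proof.
rewrite /coord1 pt0 pt1; transitivity (o * (d1 * w2 - d2 * w1) * x).
  by ring.
by rewrite dw mul1r.
Qed.

Lemma coord2K x y : coord2 (frame x y) = y.
Proof.
rewrite /coord2 pt0 pt1; transitivity (o * (d1 * w2 - d2 * w1) * y).
  by ring.
by rewrite dw mul1r.
Qed.

Lemma coord_int u : integral u -> int2 (coord1 u) (coord2 u).
Proof.
move=> ui; case: ri di wi => ? ? [? ?] [? ?].
by split; rewrite !(rpredM, rpredB).
Qed.

Lemma frame_int x y : int2 x y -> integral (frame x y).
Proof.
case=> xi yi; case: ri di wi => ? ? [? ?] [? ?]; apply/integral2.
by rewrite pt0 pt1; split; rewrite !(rpredM, rpredD).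
Qed.

Lemma conv_convex2 W : convex2 (fun x y => conv W (frame x y)).
Proof. by move=> x1 x2 y1 y2 t t01 Wx Wy; rewrite frameA; exact: conv_convex. Qed.

Lemma conv_lattice_edges W : lattice_polytope W ->
  lattice_edges (fun x y => conv W (frame x y)).
Proof.
move=> Wi k1 k2 q1 q2 Wk Wq.
have [a [t [t01 [Wx [le lt]]]]] := conv_exit Wk Wq.
rewrite -frameA in Wx le lt.
set x1 := k1 + t * _ in Wx le lt *; set x2 := k2 + t * _ in Wx le lt *.
pose A := dotv a (pt r1 r2) - dotv a (frame x1 x2).
have AE x y : A + dotv a (pt d1 d2) * x + dotv a (pt w1 w2) * y =
  dotv a (frame x y) - dotv a (frame x1 x2) by rewrite /A !frame_dotv; ring.
exists A, (dotv a (pt d1 d2)), (dotv a (pt w1 w2)), t, x1, x2; split=> //.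
split; first split=> //.
- by move=> x y Wxy; rewrite AE subr_le0; exact: conv_le Wxy.
- by rewrite AE subrr.
- by rewrite AE subr_gt0.
move=> xNi; have a0 : a <> 0 by move=> a0; move: lt; rewrite a0 !dotv0l ltxx.
have xW : frame x1 x2 \notin W.
  apply/negP => /Wi /coord_int.
  by rewrite coord1K coord2K.
have [e [f [s [eW fW s01 [ae af xE]]]]] := tight_segment Wx le a0 xW.
exists (coord1 e), (coord2 e), (coord1 f), (coord2 f), s.
rewrite !AE !frameK ae af subrr; split.
  by split; [exact/coord_int/Wi|exact/coord_int/Wi|exact: conv_mem|exact: conv_mem].
do 2!split=> //.
  by rewrite -(coord1K x1 x2) xE /coord1 !mxE; ring.
by rewrite -(coord2K x1 x2) xE /coord2 !mxE; ring.
Qed.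

End Frame.

(** * Pairs of lattice polygons *)

Section PlanarIDP.
Variable R : realType.
Implicit Types (W : seq 'rV[R]_2) (a u v z : 'rV[R]_2).

Lemma conv_edge_refines (r1 r2 d1 d2 w1 w2 o : R) W W' z :
  int2 r1 r2 -> int2 d1 d2 -> int2 w1 w2 -> o \is a Num.int ->
  o * (d1 * w2 - d2 * w1) = 1 -> lattice_polytope W ->
  two_maximizers_refine W W' ->
  edge_refines (fun x y => conv W (frame r1 r2 d1 d2 w1 w2 x y))
    (fun x y => conv [seq z - v | v <- W'] (frame r1 r2 d1 d2 w1 w2 x y)).
Proof.
move=> ri di wi oi dw Wi ref B C [v1 [v2 [u1 [u2 [[vi ui Qv Qu vu] max]]]]].
set fr := frame _ _ _ _ _ _ in Qv Qu max *.
(* The functional with values [B] and [C] on the two axes of the frame. *)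
pose a := pt (o * (B * w2 - C * d2)) (o * (C * d1 - B * w1)).
pose k := dotv a (pt r1 r2).
have aE x y : dotv a (fr x y) = k + (B * x + C * y).
  rewrite frame_dotv -addrA !(dotv2 a (pt _ _)) !pt0 !pt1.
  rewrite /k dotv2 !pt0 !pt1; congr (_ + _).
  transitivity (o * (d1 * w2 - d2 * w1) * (B * x + C * y)); first by ring.
  by rewrite dw mul1r.
have frK (u : 'rV[R]_2) : fr (coord1 r1 r2 w1 w2 o u) (coord2 r1 r2 d1 d2 o u) = u.
  exact: frameK.
have subA : forall x y t, z - (x + t *: (y - x)) = (z - x) + t *: ((z - y) - (z - x)).
  by move=> x y t; apply/rowP => i; rewrite !mxE; ring.
have [V W'V VE] := conv_map_inv subA Qv.
have [U W'U UE] := conv_map_inv subA Qu.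
have Qmax u : u \in W' -> dotv (- a) u <= dotv (- a) V /\ dotv (- a) u <= dotv (- a) U.
  move=> uW'; have [] := max (coord1 r1 r2 w1 w2 o (z - u))
    (coord2 r1 r2 d1 d2 o (z - u)).
    by rewrite frK; apply: conv_mem; exact: map_f.
  rewrite -(lerD2l k) -!aE frK VE => hV.
  rewrite -(lerD2l k) -!aE frK UE => hU.
  by move: hV hU; rewrite !dotvE => hV hU; split; lra.
have VU : V <> U.
  move=> VU; apply: vu; move: VE UE; rewrite VU => <- h.
  have := congr1 (coord1 r1 r2 w1 w2 o) h; rewrite !coord1K // => ->.
  by have := congr1 (coord2 r1 r2 d1 d2 o) h; rewrite !coord2K // => ->.
have [v [w [[vW vmax] [wW wmax] vw]]] := ref (- a) (two_maximizers W'V W'U VU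
  (fun u uW => proj1 (Qmax u uW)) (fun u uW => proj2 (Qmax u uW))).
exists (coord1 r1 r2 w1 w2 o v), (coord2 r1 r2 d1 d2 o v).
exists (coord1 r1 r2 w1 w2 o w), (coord2 r1 r2 d1 d2 o w); split.
  rewrite !frK; split;
    [exact/coord_int/Wi|exact/coord_int/Wi|exact: conv_mem|exact: conv_mem|].
  by move=> [h1 h2]; apply: vw; rewrite -(frK v) -(frK w) h1 h2.
by move=> x y Wxy; split; rewrite -(lerD2l k) -!aE !frK -lerN2 -!dotvNl;
exact: conv_le Wxy.
Qed.

Theorem lattice_polygons_idp W W' : lattice_polytope W -> lattice_polytope W' ->
  two_maximizers_refine W W' -> IDP_pair (conv W) (conv W').
Proof.
move=> Wi W'i ref z zi [x [y [Wx [W'y zE]]]].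
apply: contrapT => noIDP.
pose W'' := [seq z - v | v <- W'].
have W''i : lattice_polytope W''.
  by move=> u /mapP[v /W'i vi ->] i; rewrite !mxE rpredB.
have subA (s : 'rV[R]_2) : forall x y t,
    s - (x + t *: (y - x)) = (s - x) + t *: ((s - y) - (s - x)).
  by move=> x' y' t; apply/rowP => i; rewrite !mxE; ring.
have nolat u : integral u -> conv W u -> conv W'' u -> False.
  move=> ui Wu /(conv_map_inv (subA z))[v W'v uE]; apply: noIDP.
  exists u, v; split=> //; last by rewrite uE subrK.
  by have -> : v = z - u by [rewrite uE subKr]; move=> i; rewrite !mxE rpredB.
have Qx : conv W'' x.
  have -> : x = z - y by rewrite zE addrK.
  exact: (conv_map (subA z)).
have [v0 v0W] := conv_nonempty Wx.
have Qv0 : ~ conv W'' v0.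
  by move=> h; apply: (nolat v0) => //; [exact: Wi|exact: conv_mem].
(* The generator [v0] is a lattice point of [conv W], so it is outside the reflected polygon. The
   exit point [X] lies in both polygons, hence is not a lattice point and is interior to an edge. *)
have [a [t [t01 [QX [le lt]]]]] := conv_exit Qx Qv0.
have WX : conv W (x + t *: (v0 - x)).
  case/andP: t01 => t0 t1.
  by apply: conv_convex => //; [rewrite t0 ltW|exact: conv_mem].
set X := x + _ in QX le lt WX.
have a0 : a <> 0 by move=> a0; move: lt; rewrite a0 !dotv0l ltxx.
have XNi : ~ integral X by move=> Xi; exact: (nolat X).
have XW : X \notin W'' by apply/negP => /W''i.
have [e [f [s [eQ fQ s01 [ae af XE]]]]] := tight_segment QX le a0 XW.
have ei := (integral2 e).1 (W''i _ eQ).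
have fi := (integral2 f).1 (W''i _ fQ).
have X1 : X 0 0 = e 0 0 + s * (f 0 0 - e 0 0) by rewrite [in LHS]XE !mxE.
have X2 : X 0 1 = e 0 1 + s * (f 0 1 - e 0 1) by rewrite [in LHS]XE !mxE.
have XNi2 : ~ int2 (X 0 0) (X 0 1) by move/integral2.
have [r1 [r2 [d1 [d2 [w1 [w2 [c [b1 [b2 [[ri di wi dw] [[c01 X1c X2c]
  [[b101 r1E r2E] [b201 rd1E rd2E]]]]]]]]]]]]] :=
  adjacent_lattice_points ei fi s01 X1 X2 XNi2.
have ad : dotv a (pt d1 d2) = 0.
  have -> : pt d1 d2 = (b2 - b1) *: (f - e).
    apply: eq_pt; rewrite !mxE /=; first by clear -r1E rd1E; lra.
    by clear -r2E rd2E; lra.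
  by rewrite !dotvE ae af subrr mulr0.
have aw : dotv a (pt w1 w2) != 0.
  apply/eqP => aw; apply: a0; apply: eq_pt; rewrite [RHS]mxE.
    transitivity (a 0 0 * (d1 * w2 - d2 * w1)); first by rewrite dw mulr1.
    transitivity (w2 * dotv a (pt d1 d2) - d2 * dotv a (pt w1 w2)).
      by rewrite !dotv2 !pt0 !pt1; ring.
    by rewrite ad aw !mulr0 subr0.
  transitivity (a 0 1 * (d1 * w2 - d2 * w1)); first by rewrite dw mulr1.
  transitivity (d1 * dotv a (pt w1 w2) - w1 * dotv a (pt d1 d2)).
    by rewrite !dotv2 !pt0 !pt1; ring.
  by rewrite ad aw !mulr0 subr0.
(* The second axis must point to the side where [a] decreases, that is, into the reflected
   polygon. *)
have {wi dw aw} [v1 [v2 [o [vi oi dv av]]]] : exists v1 v2 o : R,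
    [/\ int2 v1 v2, o \is a Num.int, o * (d1 * v2 - d2 * v1) = 1 &
      dotv a (pt v1 v2) < 0].
  case: wi => w1i w2i; move: aw; rewrite neq_lt => /orP[aw|aw].
    by exists w1, w2, 1; rewrite rpred1 mul1r.
  exists (- w1), (- w2), (-1); split; rewrite ?rpredN ?rpred1 //.
  - by split; rewrite rpredN.
  - by rewrite -[RHS]dw; ring.
  - by move: aw; rewrite !dotv2 !pt0 !pt1; clear; lra.
pose fr := frame r1 r2 d1 d2 v1 v2.
have fr00 : fr 0 0 = e + b1 *: (f - e).
  by apply: eq_pt; rewrite !mxE /= !mul0r !addr0.
have fr10 : fr 1 0 = e + b2 *: (f - e).
  by apply: eq_pt; rewrite !mxE /= !mul0r !mul1r !addr0.
have frX : fr c 0 = X.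
  by apply: eq_pt; rewrite /fr /frame ?pt0 ?pt1 !mul0r !addr0.
apply: (@no_crossing _ (fun x y => conv W (fr x y))
  (fun x y => conv W'' (fr x y)) c) => //.
- exact: conv_convex2.
- exact: conv_convex2.
- exact: conv_lattice_edges dv _ Wi.
- exact: conv_lattice_edges dv _ W''i.
- exact: conv_edge_refines dv _ _.
- move=> i j ii ji; apply: nolat; apply: frame_int => //.
- move=> x' y' Q'; have := conv_le le Q'.
  rewrite -frX !frame_dotv ad !mulr0 mul0r !addr0.
  by rewrite gerDl nmulr_lle0.
- by rewrite fr00; apply: conv_convex => //; exact: conv_mem.
- by rewrite fr10; apply: conv_convex => //; exact: conv_mem.
- by rewrite frX.
Qed.
End PlanarIDP.

(** * Faces of polytopes *)

Section Faces.
Variables (R : realType) (n : nat).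
Implicit Types (V : seq 'rV[R]_n) (P F G : set 'rV[R]_n) (a g x y : 'rV[R]_n).

Definition argmax P g : set 'rV[R]_n :=
  [set x | P x /\ forall y, P y -> dotv g y <= dotv g x].

Lemma argmax_is_face P g x : argmax P g x -> is_face P (argmax P g).
Proof.
move=> [Px max]; exists g, (dotv g x); split=> //; apply/seteqP; split=> y /=.
  by move=> [Py ymax]; split=> //; apply/eqP; rewrite eq_le max // ymax.
by move=> [Py yx]; split=> // z /max; rewrite yx.
Qed.

Lemma face_argmax P F x : is_face P F -> F x -> exists g, F = argmax P g.
Proof.
move=> [g [b [le ->]]] [Px xb]; exists g; apply/seteqP; split=> y /=.
  by move=> [Py yb]; split=> // z /le; rewrite yb.
move=> [Py ymax]; split=> //; apply/eqP; rewrite eq_le le //= -xb.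
exact: ymax.
Qed.

Lemma argmax_eq P g x y : argmax P g x -> argmax P g y -> dotv g x = dotv g y.
Proof.
by move=> [Px xm] [Py ym]; apply/eqP; rewrite eq_le xm // ym.
Qed.

Lemma face_sub P F : is_face P F -> F `<=` P.
Proof. by move=> [c [b [_ ->]]] x []. Qed.

Lemma faceI P F G : is_face P F -> is_face P G -> is_face P (F `&` G).
Proof.
move=> [c [b [le ->]]] [c' [b' [le' ->]]]; exists (c + c'), (b + b'); split.
  by move=> x Px; rewrite dotvDl lerD ?le ?le'.
apply/seteqP; split=> x /=.
  by move=> [[Px xb] [_ xb']]; rewrite dotvDl xb xb'.
move=> [Px]; rewrite dotvDl => E; have := le _ Px; have := le' _ Px.
by move=> h h'; do 2!split=> //; lra.
Qed.

Lemma face0 P : is_face P set0.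
Proof.
exists 0, 1; split=> [x _|]; first by rewrite dotv0l ler01.
apply/seteqP; split=> // x [_ /=]; rewrite dotv0l => /eqP.
by rewrite eq_sym oner_eq0.
Qed.

Lemma seq_max (T : eqType) (s : seq T) (h : T -> R) (x : T) : x \in s ->
  exists2 y, y \in s & forall z, z \in s -> h z <= h y.
Proof.
elim: s x => // y s IH x _; case: s IH => [|w s] IH.
  by exists y; rewrite ?mem_head // => z; rewrite inE => /eqP ->.
have [v vs vmax] := IH w (mem_head _ _).
have [yv|vy] := leP (h y) (h v).
  by exists v; rewrite 1?in_cons ?vs ?orbT // => z; rewrite in_cons => /predU1P[->|/vmax].
exists y; rewrite ?mem_head // => z; rewrite in_cons => /predU1P[->//|/vmax].
by move/le_trans; apply; exact: ltW.
Qed.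

Lemma argmax_conv_nonempty V v g : v \in V -> exists2 w, w \in V & argmax (conv V) g w.
Proof.
move=> /(seq_max (dotv g))[w wV wmax]; exists w => //; split.
  exact: conv_mem.
by move=> y; apply: conv_le.
Qed.

Lemma conv_eq V a m x : (forall v, v \in V -> dotv a v = m) -> conv V x ->
  dotv a x = m.
Proof.
move=> Vm Vx; apply/eqP; rewrite eq_le (conv_le _ Vx) => [/=|v /Vm -> //].
rewrite -lerN2 -dotvNl (conv_le _ Vx) // => v /Vm; rewrite dotvNl => ->.
exact: lexx.
Qed.

Lemma argmax_tight V g x : argmax (conv V) g x ->
  conv [seq v <- V | dotv g v == dotv g x] x.
Proof.
by move=> [Vx max]; apply: conv_tight => // v vV; apply/max/conv_mem.
Qed.

(** A lexicographic maximum: [h] only breaks ties of [g]. Finitely many generators lie off the face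
    of [g], so one small [e] keeps all of them from catching up. *)
Lemma argmax_perturb V g h x0 : argmax (conv V) g x0 ->
  (forall y, argmax (conv V) g y -> dotv h y <= dotv h x0) ->
  exists2 e : R, 0 < e & forall x, argmax (conv V) (g + e *: h) x <->
    argmax (conv V) g x /\ dotv h x = dotv h x0.
Proof.
move=> gx0 hmax; set m := dotv g x0; set M := dotv h x0.
have [e e0 eP] : exists2 e, 0 < e & forall e', 0 < e' <= e -> forall v, v \in V ->
    dotv g v < m -> dotv g v + e' * dotv h v < m + e' * M.
  elim: (V) => [|v W [e e0 eP]]; first by exists 1.
  pose d := (m - dotv g v) / (`|dotv h v - M| + 1).
  have D0 : 0 < `|dotv h v - M| + 1 by rewrite ltr_wpDl.
  have [vm|vm] := ltP (dotv g v) m; last first.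
    exists e => // e' e'e w; rewrite inE => /predU1P[->|]; last exact: eP.
    by rewrite ltNge vm.
  have d0 : 0 < d by rewrite divr_gt0 // subr_gt0.
  exists (Num.min e d); first by rewrite lt_min e0.
  move=> e' /andP[e'0]; rewrite le_min => /andP[e'e e'd] w.
  rewrite inE => /predU1P[->|wW] wm; last by apply: eP; rewrite // e'0.
  have : e' * (`|dotv h v - M| + 1) <= m - dotv g v by rewrite -ler_pdivlMr.
  have : e' * (dotv h v - M) <= e' * `|dotv h v - M|.
    by rewrite ler_pM2l // ler_norm.
  by clear -e'0; lra.
have {}eP := eP e; exists e => // x.
have gle v : v \in V -> dotv g v <= m by move=> /conv_mem; exact: gx0.2.
have le v : v \in V -> dotv (g + e *: h) v <= m + e * M.
  move=> vV; rewrite !dotvE; have := gle v vV; rewrite le_eqVlt => /predU1P[gv|gv].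
    rewrite gv lerD2l ler_pM2l //; apply: hmax; split; first exact: conv_mem.
    by move=> y /gx0.2; rewrite gv.
  by apply/ltW/eP; rewrite ?e0 ?lexx.
split=> [gex|[gx hx]]; last first.
  have gxm : dotv g x = m by exact: argmax_eq gx gx0.
  split; first exact: gx.1.
  by move=> y Vy; rewrite !dotvE gxm hx -dotvZl -dotvDl; exact: conv_le Vy.
have ex : dotv (g + e *: h) x = m + e * M.
  apply/eqP; rewrite eq_le (conv_le le gex.1) /=.
  by rewrite /m /M -dotvZl -dotvDl; apply: gex.2; exact: gx0.1.
have xT := conv_tight le gex.1 ex.
have tight v : v \in [seq v <- V | dotv (g + e *: h) v == m + e * M] ->
    dotv g v = m /\ dotv h v = M.
  rewrite mem_filter !dotvE => /andP[/eqP E vV].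
  have gv : dotv g v = m.
    have := gle v vV; rewrite le_eqVlt => /predU1P[//|gv].
    by have := eP _ v vV gv; rewrite e0 lexx E ltxx => /(_ isT).
  by split=> //; apply: (mulfI (negbT (gt_eqF e0))); move: E; rewrite gv => /addrI.
have gx : dotv g x = m by apply: conv_eq xT => v /tight[].
split; last by apply: conv_eq xT => v /tight[].
by split; [exact: gex.1|move=> y /gx0.2; rewrite gx].
Qed.

(** Take the longest generator [v] on the face. As [dotv (v - w) (v - w)] is nonnegative, the
    functional [v] is maximal among these generators only at [v], so perturbing by it exposes [v]
    alone. *)
Lemma vertex_in_face V F x : is_face (conv V) F -> F x ->
  exists v, [/\ v \in V, F v & is_vertex (conv V) v].
Proof.
move=> Ff Fx; have [g Fg] := face_argmax Ff Fx; rewrite Fg in Fx *.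
have [w0 w0T] := conv_nonempty (argmax_tight Fx).
have [v vT vmax] := seq_max (fun w => dotv w w) w0T.
have TF w : w \in [seq v <- V | dotv g v == dotv g x] -> argmax (conv V) g w.
  rewrite mem_filter => /andP[/eqP gw wV]; split; first exact: conv_mem.
  by rewrite gw; exact: Fx.2.
have FT y : argmax (conv V) g y -> conv [seq v <- V | dotv g v == dotv g x] y.
  move=> gy; rewrite (argmax_eq Fx gy).
  exact: argmax_tight.
have sq w : dotv (v - w) (v - w) = dotv v v - 2 * dotv v w + dotv w w.
  by rewrite !dotvE (dotvC w v); ring.
have vw w : w \in [seq v <- V | dotv g v == dotv g x] -> dotv v w <= dotv v v.
  by move=> /vmax; have := dotv_ge0 (v - w); rewrite sq; lra.
have [|e e0 eP] := argmax_perturb (h := v) (TF _ vT).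
  by move=> y /FT; exact: conv_le.
have set1E : argmax (conv V) (g + e *: v) = [set v].
  apply/seteqP; split=> y /=.
    move=> /eP[/FT yT /(conv_tight vw yT)].
    move: y {yT}; apply: (@conv_min _ _ _ [set y | y = v]) => /=.
      by move=> ? ? t _ -> ->; rewrite subrr scaler0 addr0.
    move=> w; rewrite mem_filter => /andP[/eqP vwE wT].
    apply/eqP; rewrite eq_sym -subr_eq0; apply/eqP/dotv_eq0; apply: le_anti.
    by rewrite dotv_ge0 andbT sq vwE; have := vmax _ wT; lra.
  by move=> ->; apply/eP; split=> //; exact: TF.
exists v; split; [by move: vT; rewrite mem_filter => /andP[]|exact: TF|].
rewrite /is_vertex -set1E; apply: (@argmax_is_face _ _ v).
by rewrite set1E.
Qed.

Lemma edge_line P E b y x : is_edge P E -> E b -> E y -> y <> b -> E x ->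
  exists l : R, x = b + l *: (y - b).
Proof.
move=> [_ [_ dim]] Eb Ey yb Ex; apply: contrapT => xl; apply: dim.
exists b, [:: x; y]; split=> //; split.
  by move=> z; rewrite !inE => /orP[] /eqP ->.
split=> //=; rewrite free_cons seq1_free subr_eq0 andbC.
apply/andP; split; first by apply/eqP.
apply/negP; rewrite span_seq1 => /vlineP[l xE]; apply: xl; exists l.
by rewrite -xE addrC subrK.
Qed.

End Faces.

(** * Faces of a prismatoid *)

Section Prism.
Variable R : realType.
Implicit Types (P F G X : set 'rV[R]_3).

(** The combinatorics needed, in a form in which [B] and [T] can be exchanged. In a prism, faces
    through [X] that leave [B] contain everything above [X], hence share a point of [T]; a face
    meeting [B] only within [X] is no more than what is above [X]. *)
Record prism_faces P B T : Prop := PrismFaces {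
  prism_face : is_face P B;
  prism_face_nonempty : B !=set0;
  prism_faces_disjoint : forall x, B x -> T x -> False;
  prism_face_lift : forall X E F, is_face P X -> X !=set0 -> X `<=` B ->
    is_face P E -> is_face P F -> X `<=` E -> X `<=` F ->
    ~ E `<=` B -> ~ F `<=` B -> exists2 y, T y & E y /\ F y;
  prism_face_lift_min : forall X E F, is_face P X -> X !=set0 -> X `<=` B ->
    is_face P E -> is_face P F -> X `<=` E -> X `<=` F ->
    ~ E `<=` B -> ~ F `<=` B -> F `&` B `<=` X -> F `<=` E }.

Lemma dotv_mulmxT (x y : 'rV[R]_3) (M : 'M[R]_3) :
  dotv (x *m M^T) y = dotv x (y *m M).
Proof.
have dotvmx (u v : 'rV[R]_3) : dotv u v = (u *m v^T) 0 0.
  by rewrite mxE; apply: eq_bigr => i _; rewrite mxE.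
by rewrite !dotvmx trmx_mul mulmxA.
Qed.

Section PrismOver.
Variables (Q : set 'rV[R]_2) (M : 'M[R]_3) (a : 'rV[R]_3).
Hypothesis Munit : M \in unitmx.

Local Notation pr := (fun q t => affmap M a (embed q t)).
Local Notation prism := (prism_set Q M a).
Local Notation level := (prism_level Q M a).
Let e3 : 'rV[R]_3 := embed 0 1.
Let axis : 'rV[R]_3 := e3 *m (invmx M)^T.
Let slope (c : 'rV[R]_3) := dotv c (e3 *m M).

Lemma embedE q t : embed q t = embed q 0 + t *: e3 :> 'rV[R]_3.
Proof.
by apply/rowP => i; rewrite !mxE; case: ifP; rewrite ?mxE ?mulr0 ?addr0 ?mulr1 ?add0r.
Qed.

Lemma dotv_prism c q s t : dotv c (pr q t) = dotv c (pr q s) + (t - s) * slope c.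
Proof.
by rewrite /affmap (embedE q t) (embedE q s) !mulmxDl -!scalemxAl !dotvE /slope; ring.
Qed.

Lemma dotv_axis q t : dotv axis (pr q t) = dotv axis a + t.
Proof.
rewrite /affmap dotvDr addrC; congr (_ + _).
rewrite /axis dotv_mulmxT mulmxK // /e3 /dotv !big_ord_recl big_ord0 !mxE /=.
by rewrite !mul0r !add0r mul1r addr0.
Qed.

Lemma prism_inj_level q q' t t' : pr q t = pr q' t' -> t = t'.
Proof. by move/(congr1 (dotv axis)); rewrite !dotv_axis => /addrI. Qed.

Variable e : R.
Hypothesis e01 : e = 0 \/ e = 1.

Let e_in : 0 <= e <= 1.
Proof. by case: e01 => ->; rewrite ?ler01 ?lexx. Qed.

Let e'_in : 0 <= 1 - e <= 1.
Proof. by case: e01 => ->; rewrite ?subr0 ?subrr ?ler01 ?lexx. Qed.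

(** The exposing functional is maximal at a point of level [e] and at one off this level. Moving
    each vertically gives opposite inequalities for its slope, which is therefore 0. *)
Lemma prism_face_vertical A0 G : A0 `<=` level e ->
  A0 !=set0 -> is_face prism G -> A0 `<=` G -> ~ G `<=` level e ->
  forall q t s, 0 <= s <= 1 -> Q q -> G (pr q t) -> G (pr q s).
Proof.
move=> A0e [x A0x] [c [b [le ->]]] A0G Ge.
have [q0 [Qq0 xE]] := A0e _ A0x.
have [_ /= xb] := A0G _ A0x; rewrite xE in xb.
have [q1 [t1 [t1e [t1_in [Qq1 q1b]]]]] : exists q1 t1, t1 != e /\ 0 <= t1 <= 1 /\
    Q q1 /\ dotv c (pr q1 t1) = b.
  apply: contrapT => h; apply: Ge => y [[q [t [Qq [t01 ->]]]] /= yb].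
  exists q; split=> //; suff -> : t = e by [].
  by apply/eqP; apply: contrapT => /negP te; apply: h; exists q, t.
have s0 : slope c = 0.
  have h0 : (1 - e - e) * slope c <= 0.
    have : dotv c (pr q0 (1 - e)) <= b by apply: le; exists q0, (1 - e).
    by rewrite (dotv_prism _ _ e) xb gerDl.
  have h1 : 0 <= (t1 - e) * slope c.
    have : dotv c (pr q1 e) <= b by apply: le; exists q1, e.
    by rewrite -q1b (dotv_prism _ _ e t1) lerDl.
  case/andP: t1_in => t10 t11; case: e01 => eE; rewrite eE in h0 h1 t1e.
    rewrite !subr0 mul1r in h0 h1.
    apply: le_anti; rewrite h0 /=.
    by rewrite -(pmulr_rge0 _ (_ : 0 < t1)) // lt_def t1e.
  rewrite subrr add0r mulN1r oppr_le0 in h0.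
  apply: le_anti; rewrite h0 andbT.
  by rewrite -(nmulr_rge0 _ (_ : t1 - 1 < 0)) // subr_lt0 lt_neqAle t1e.
move=> q t s s_in Qq [_ /= qb]; split; first by exists q, s.
by rewrite /= (dotv_prism _ _ t) qb s0 mulr0 addr0.
Qed.

Definition vertical_over (A0 : set 'rV[R]_3) : set 'rV[R]_3 :=
  [set x | exists q t, [/\ Q q, 0 <= t <= 1, A0 (pr q e) & x = pr q t]].

(** Subtracting [slope c] times the level functional makes the exposing functional constant on
    vertical segments. *)
Lemma vertical_over_face A0 : is_face prism A0 -> is_face prism (vertical_over A0).
Proof.
move=> [c [b [le ->]]].
exists (c - slope c *: axis), (b - slope c * (e + dotv axis a)).
have E q t : dotv (c - slope c *: axis) (pr q t) =
    dotv c (pr q e) - slope c * (e + dotv axis a).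
  by rewrite dotvBl dotvZl dotv_axis (dotv_prism _ _ e); ring.
split.
  move=> x [q [t [Qq [t01 ->]]]]; rewrite E lerD2r; apply: le.
  by exists q, e.
apply/seteqP; split=> x /=.
  move=> [q [t [Qq t01 [_ /= qb] ->]]]; rewrite E qb; split=> //.
  by exists q, t.
move=> [[q [t [Qq [t01 ->]]]]]; rewrite E => /addIr qb; exists q, t; split=> //.
by split=> //; exists q, e.
Qed.

End PrismOver.

Section PrismIso.
Variables (P Pr : set 'rV[R]_3) (f : set 'rV[R]_3 -> set 'rV[R]_3).
Hypothesis iso : face_lattice_iso P Pr f.

Lemma iso_face F : is_face P F -> is_face Pr (f F).
Proof. by case: iso => h _ _; exact: h. Qed.

Lemma iso_onto G : is_face Pr G -> exists2 F, is_face P F & f F = G.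
Proof. by case: iso => _ h _ /h[F []]; exists F. Qed.

Lemma iso_sub F G : is_face P F -> is_face P G -> F `<=` G <-> f F `<=` f G.
Proof. by case: iso => _ _ h; exact: h. Qed.

Lemma iso_meet F G : is_face P F -> is_face P G -> f (F `&` G) = f F `&` f G.
Proof.
move=> Ff Gf; have FGf := faceI Ff Gf; apply/seteqP; split.
  by move=> x fx; split; move: fx; apply/(iso_sub _ _).1 => // y [].
have [H Hf HE] := iso_onto (faceI (iso_face Ff) (iso_face Gf)).
rewrite -HE; apply/(iso_sub Hf FGf).1 => y Hy.
by split; move: y Hy; apply/(iso_sub _ _).2 => //; rewrite HE => z [].
Qed.

Lemma iso_nonempty F : is_face P F -> (f F !=set0 <-> F !=set0).
Proof.
move=> Ff; split=> [[y fy]|[x Fx]].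
  apply: contrapT => F0; have [G Gf G0] := iso_onto (face0 Pr).
  suff : f F `<=` f G by move=> /(_ y fy); rewrite G0.
  by apply/(iso_sub Ff Gf) => x Fx; case: F0; exists x.
apply: contrapT => f0.
suff : F `<=` set0 by move=> /(_ x Fx).
by apply/(iso_sub Ff (face0 P)) => y fy; case: f0; exists y.
Qed.

End PrismIso.

(** The isomorphism respects inclusions, intersections and emptiness, so it suffices to see in the
    prism that the face above [f X] lies in [f E] and in [f F] and meets the opposite level. Taking
    [e] as 0 or 1 treats bottom and top at once. *)
Lemma prism_faces_of_iso P Q M a f e B T : M \in unitmx -> Q !=set0 ->
  (e = 0 \/ e = 1) -> face_lattice_iso P (prism_set Q M a) f ->
  is_face P B -> is_face P T ->
  f B = prism_level Q M a e -> f T = prism_level Q M a (1 - e) ->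
  prism_faces P B T.
Proof.
move=> Mu [q0 Qq0] e01 iso Bf Tf fB fT.
have e_in : 0 <= e <= 1 by case: e01 => ->; rewrite ?ler01 ?lexx.
have e'_in : 0 <= 1 - e <= 1.
  by case: e01 => ->; rewrite ?subr0 ?subrr ?ler01 ?lexx.
have ee' : e <> 1 - e by case: e01 => ->; clear; lra.
have lift X E F : is_face P X -> X !=set0 -> X `<=` B ->
    is_face P E -> is_face P F -> X `<=` E -> X `<=` F ->
    ~ E `<=` B -> ~ F `<=` B ->
  (exists2 y, T y & E y /\ F y) /\ (F `&` B `<=` X -> F `<=` E).
  move=> Xf X0 XB Ef Ff XE XF EB FB.
  have fX0 := (iso_nonempty iso Xf).2 X0.
  have fXB : f X `<=` prism_level Q M a e.
    by rewrite -fB; apply/(iso_sub iso _ _).1.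
  have vert G : is_face P G -> X `<=` G -> ~ G `<=` B ->
      forall q t s, 0 <= s <= 1 -> Q q -> f G (affmap M a (embed q t)) ->
      f G (affmap M a (embed q s)).
    move=> Gf XG GB; apply: (prism_face_vertical e01 fXB fX0).
    - exact: iso_face iso _ Gf.
    - exact: (iso_sub iso Xf Gf).1.
    - by rewrite -fB => h; apply/GB/(iso_sub iso Gf Bf).2.
  have sub G : is_face P G -> X `<=` G -> ~ G `<=` B ->
      vertical_over Q M a e (f X) `<=` f G.
    move=> Gf XG GB x [q [t [Qq t01 Xq ->]]]; apply: (vert G Gf XG GB q e) => //.
    exact: (iso_sub iso Xf Gf).1 XG _ Xq.
  have Vf := vertical_over_face Mu e01 (iso_face iso Xf).
  split.
    have [G Gf GE] := iso_onto iso Vf.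
    have [|y [Gy Ty]] := (iso_nonempty iso (faceI Gf Tf)).1.
      have [x fXx] := fX0; have [q [Qq xE]] := fXB _ fXx.
      exists (affmap M a (embed q (1 - e))); rewrite (iso_meet iso) //; split.
        by rewrite GE; exists q, (1 - e); rewrite -xE.
      by rewrite fT; exists q.
    exists y => //; split; move: y Gy {Ty}; apply/(iso_sub iso _ _).2 => //;
    by rewrite GE; exact: sub.
  move=> FX; apply/(iso_sub iso Ff Ef).2 => x fx.
  have [q [t [Qq [t01 xE]]]] := face_sub (iso_face iso Ff) fx.
  apply: (sub E Ef XE EB); exists q, t; split=> //.
  apply: (iso_sub iso (faceI Ff Bf) Xf).1 FX _ _.
  rewrite (iso_meet iso) //; split.
    by apply: (vert F Ff XF FB q t) => //; rewrite -xE.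
  by rewrite fB; exists q.
split=> //.
- apply/(iso_nonempty iso Bf).1; rewrite fB.
  by exists (affmap M a (embed q0 e)), q0.
- move=> x Bx Tx; have [|y] := (iso_nonempty iso (faceI Bf Tf)).2.
    by exists x.
  rewrite (iso_meet iso) // fB fT => -[[q [_ ->]] [q' [_ /(prism_inj_level Mu)]]].
  exact: ee'.
- move=> X E F Xf X0 XB Ef Ff XE XF EB FB.
  by have [] := lift X E F Xf X0 XB Ef Ff XE XF EB FB.
- move=> X E F Xf X0 XB Ef Ff XE XF EB FB.
  by have [] := lift X E F Xf X0 XB Ef Ff XE XF EB FB.
Qed.

Lemma prismatoid_faces P : prismatoid3 P -> exists B T,
  [/\ prism_faces P B T, prism_faces P T B, lin T = lin B &
    forall F, is_face P F -> F !=set0 -> (F `&` B) !=set0 \/ (F `&` T) !=set0].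
Proof.
move=> [VQ [M [a [f [[[q0 [s [Qq0 _]]] _] [Mu [iso [T [B [Tf Bf fT fB par]]]]]]]]]].
have Q0 : conv VQ !=set0 by exists q0.
exists B, T; split=> //.
- apply: (prism_faces_of_iso (e := 0) Mu Q0 _ iso) => //; first by left.
  by rewrite subr0.
- apply: (prism_faces_of_iso (e := 1) Mu Q0 _ iso) => //; first by right.
  by rewrite subrr.
- move=> F Ff F0.
  have [x fx] := (iso_nonempty iso Ff).2 F0.
  have [q [t [Qq [/andP[t0 t1] xE]]]] := face_sub (iso_face iso Ff) fx.
  have [c [b [le FE]]] := iso_face iso Ff.
  have xb : dotv c (affmap M a (embed q t)) = b.
    by move: fx; rewrite FE -xE => -[].
  have mem s' : 0 <= s' <= 1 -> b <= dotv c (affmap M a (embed q s')) ->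
      f F (affmap M a (embed q s')).
    move=> s01 bs; rewrite FE; split; first by exists q, s'.
    by apply: le_anti; rewrite bs le //; exists q, s'.
  (* Along the vertical segment through a point of the face, the functional is affine and stays
     maximal towards the end where it does not decrease. *)
  have [s0|s0] := leP 0 (dotv c ((embed 0 1 : 'rV_3) *m M)); [right|left].
    apply/(iso_nonempty iso (faceI Ff Tf)).1; rewrite (iso_meet iso) //.
    exists (affmap M a (embed q 1)); split; last by rewrite fT; exists q.
    apply: mem; first by rewrite ler01 lexx.
    by rewrite (dotv_prism _ _ _ _ t) xb lerDl mulr_ge0 // subr_ge0.
  apply/(iso_nonempty iso (faceI Ff Bf)).1; rewrite (iso_meet iso) //.
  exists (affmap M a (embed q 0)); split; last by rewrite fB; exists q.
  apply: mem; first by rewrite ler01 lexx.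
  by rewrite (dotv_prism _ _ _ _ t) xb lerDl mulr_le0 ?(ltW s0) // sub0r oppr_le0.
Qed.

End Prism.

(** * Vertical edges of a smooth prismatoid *)

Section VerticalEdges.
Variable R : realType.
Implicit Types (P E F : set 'rV[R]_3) (u b x y z : 'rV[R]_3).

Lemma Zbasis3_rot u1 u2 u3 : Zbasis3 u1 u2 u3 -> Zbasis3 u2 u3 u1.
Proof.
move=> [i1 i2 i3 fr gen]; split=> //.
  by rewrite (perm_free (_ : perm_eq _ [:: u1; u2; u3])) // -(perm_rot 2) /=.
move=> z /gen[a1 [a2 [a3 [ai1 ai2 ai3 ->]]]]; exists a2, a3, a1; split=> //.
by rewrite [RHS]addrC addrA.
Qed.

Lemma Zbasis3_indep u1 u2 u3 k : Zbasis3 u1 u2 u3 -> u1 <> k *: u2.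
Proof.
move=> [_ _ _ + _] u12; rewrite free_cons => /andP[/negP u1N _]; apply: u1N.
by rewrite u12 memvZ // memv_span // !inE eqxx.
Qed.

Lemma Zbasis3_dotv0 u1 u2 u3 (c : 'rV[R]_3) : Zbasis3 u1 u2 u3 ->
  dotv c u1 = 0 -> dotv c u2 = 0 -> dotv c u3 = 0 -> c = 0.
Proof.
move=> [_ _ _ _ gen] c1 c2 c3; apply/rowP => i.
have [j|a1 [a2 [a3 [_ _ _ dE]]]] := gen (delta_mx 0 i).
  by rewrite mxE rpred_nat.
by rewrite -dotv_delta dotvC dE !dotvE c1 c2 c3 !mulr0 !addr0 mxE.
Qed.

Definition vertical_edge P (B : set 'rV[R]_3) b E u := exists u1 u2,
  [/\ is_edge P E, E b, ~ E `<=` B & exists2 t : R, 0 < t & E (b + t *: u)] /\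
  [/\ Zbasis3 u1 u2 u, exists2 t : R, 0 < t & B (b + t *: u1) &
      exists2 t : R, 0 < t & B (b + t *: u2)].

(** Exactly one of the three edges at [b] leaves [B]. Two such edges would share a point of [T]
    besides [b] and be parallel, against the basis property; if there were none, the functional
    exposing [B] would vanish on a basis and [B] would contain [T]. *)
Lemma vertical_edge_exists P B T b : prism_faces P B T -> T !=set0 ->
  T `<=` P -> smooth3 P -> is_vertex P b -> B b ->
  exists E u, vertical_edge P B b E u.
Proof.
move=> pf [t0 Tt0] TP [_ smooth] bv Bb.
have [E1 [E2 [E3 [u1 [u2 [u3 [[e1 e2 e3] [[b1 b2 b3] [_ [[p1 p2 p3] zb]]]]]]]]]] :=
  smooth b bv.
have along E u : prim_dir b E u -> exists2 t : R, 0 < t & E (b + t *: u).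
  by move=> [[_ [_ [t [t_gt0 Et]]]] _]; exists t.
have par E F u v : is_edge P E -> is_edge P F -> E b -> F b ->
    prim_dir b E u -> prim_dir b F v -> (forall k : R, u <> k *: v) ->
    ~ E `<=` B -> F `<=` B.
  move=> Ee Fe Eb Fb [[_ [u0 [t [tp Et]]]] _] [[_ [v0 [s [sp Fs]]]] _] uv EB.
  apply: contrapT => FB.
  have b1B : [set b] `<=` B by move=> _ ->.
  have bE : [set b] `<=` E by move=> _ ->.
  have bF : [set b] `<=` F by move=> _ ->.
  have [|y Ty [Ey Fy]] := prism_face_lift pf bv _ b1B Ee.1 Fe.1 bE bF EB FB.
    by exists b.
  have yb : y <> b by move=> yb; apply: (prism_faces_disjoint pf Bb); rewrite -yb.
  have [l lE] := edge_line Ee Eb Ey yb Et.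
  have [m mE] := edge_line Fe Fb Fy yb Fs.
  move/addrI: lE => lE; move/addrI: mE => mE.
  have m0 : m != 0.
    apply: contra_neq v0 => m0; apply/eqP; move: mE; rewrite m0 scale0r => /eqP.
    by rewrite scaler_eq0 gt_eqF.
  apply: (uv (t^-1 * (l * (m^-1 * s)))).
  rewrite -!scalerA mE (scalerA m^-1) mulVf // scale1r -lE scalerA mulVf ?scale1r //.
  by rewrite gt_eqF.
have zb2 := Zbasis3_rot zb; have zb3 := Zbasis3_rot zb2.
have mk E F G u v w : is_edge P E -> E b -> ~ E `<=` B -> F `<=` B -> G `<=` B ->
    prim_dir b E u -> prim_dir b F v -> prim_dir b G w -> Zbasis3 v w u ->
    exists E u, vertical_edge P B b E u.
  move=> Ee Eb EB FB GB pE /along[t tp Ft] /along[s sp Gs] z.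
  exists E, u, v, w; split; first by split=> //; exact: along.
  by split=> //; [exists t => //; exact: FB|exists s => //; exact: GB].
have ne u v w : Zbasis3 u v w -> forall k : R, u <> k *: v.
  by move=> z k; exact: Zbasis3_indep z.
have ne' u v w : Zbasis3 u v w -> forall k : R, v <> k *: u.
  move=> z k vE; have k0 : k != 0.
    apply/eqP => k0; move: vE; rewrite k0 => vE.
    by apply: (Zbasis3_indep (k := 0) (Zbasis3_rot z)); rewrite vE !scale0r.
  by apply: (Zbasis3_indep (k := k^-1) z); rewrite vE scalerA mulVf // scale1r.
have [B1|B1] := EM (E1 `<=` B); last first.
  apply: (mk E1 E2 E3 u1 u2 u3) => //.
  - exact: par e1 e2 b1 b2 p1 p2 (ne _ _ _ zb) B1.
  - exact: par e1 e3 b1 b3 p1 p3 (ne' _ _ _ zb3) B1.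
have [B2|B2] := EM (E2 `<=` B); last first.
  apply: (mk E2 E3 E1 u2 u3 u1) => //.
  exact: par e2 e3 b2 b3 p2 p3 (ne _ _ _ zb2) B2.
have [B3|B3] := EM (E3 `<=` B); last by apply: (mk E3 E1 E2 u3 u1 u2).
have [g [m [le BE]]] := prism_face pf.
have gb : dotv g b = m by move: Bb; rewrite BE => -[].
have g0 E u : E `<=` B -> prim_dir b E u -> dotv g u = 0.
  move=> EB /along[t tp /EB]; rewrite BE => -[_ /=]; rewrite !dotvE gb.
  move=> /eqP; rewrite -subr_eq0 addrAC subrr add0r mulf_eq0 gt_eqF //=.
  by move/eqP.
have gE : g = 0.
  apply: (Zbasis3_dotv0 zb); [exact: g0 p1|exact: g0 p2|exact: g0 p3].
case: (prism_faces_disjoint pf (x := t0)) => //.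
by rewrite BE; split; [exact: TP|rewrite /= -gb gE !dotv0l].
Qed.

Lemma lin_const F (g : 'rV[R]_3) m v : (forall x, F x -> dotv g x = m) -> lin F v ->
  dotv g v = 0.
Proof.
move=> Fm [s [c [sF ->]]].
have add : dotv g (\sum_(i < size s) c`_i *: ((nth (0, 0) s i).1 - (nth (0, 0) s i).2)) =
  \sum_(i < size s) dotv g (c`_i *: ((nth (0, 0) s i).1 - (nth (0, 0) s i).2)).
  by apply: (big_morph (dotv g)) => [x y|]; rewrite !dotvE.
rewrite add big1 // => i _.
have [F1 F2] := sF _ (mem_nth (0, 0) (ltn_ord i)).
by rewrite !dotvE !Fm // subrr mulr0.
Qed.

Lemma lin_diff F x y : F x -> F y -> lin F (x - y).
Proof.
move=> Fx Fy; exists [:: (x, y)], [:: 1]; split.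
  by move=> p; rewrite inE => /eqP ->.
by rewrite big_ord_recl big_ord0 addr0 scale1r.
Qed.

Definition height_functional P B T (c : 'rV[R]_3) (lo hi : R) :=
  [/\ forall z, integral z -> dotv c z \is a Num.int,
      forall x, P x -> lo <= dotv c x <= hi, lo < hi,
      forall x, B x <-> P x /\ dotv c x = lo &
      forall x, T x <-> P x /\ dotv c x = hi].

(** The functional exposing [B] is scaled to be 1 on the edge direction leaving [B]; it vanishes on
    the two others, so it is a dual basis vector and integral. The functional exposing [T] vanishes
    on [lin B] and is thus a multiple of it, positive because [B] and [T] are disjoint. *)
Lemma height_exists P B T b : prism_faces P B T -> T !=set0 -> is_face P T ->
  smooth3 P -> lin T = lin B -> is_vertex P b -> B b ->
  exists c lo hi u1 u2 u3, height_functional P B T c lo hi /\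
    [/\ Zbasis3 u1 u2 u3, dotv c u1 = 0, dotv c u2 = 0 & dotv c u3 = 1].
Proof.
move=> pf T0 Tf sm par bv Bb; have TP := face_sub Tf.
have [E [u3 [u1 [u2 [[Ee Eb EB [t3 t3p Et3]] [zb [t1 t1p Bt1] [t2 t2p Bt2]]]]]]] :=
  vertical_edge_exists pf T0 TP sm bv Bb.
have [g [m [le BE]]] := prism_face pf.
have Bg x : B x -> dotv g x = m by rewrite BE => -[].
have dir t u : 0 < t -> B (b + t *: u) -> forall h, lin B `<=` [set v | dotv h v = 0] ->
    dotv h u = 0.
  move=> tp Bt h hB; have /hB := lin_diff Bt Bb; rewrite /= addrAC subrr add0r dotvZr.
  by move/eqP; rewrite mulf_eq0 gt_eqF //= => /eqP.
have g0 : lin B `<=` [set v | dotv g v = 0] by move=> v; apply: lin_const Bg.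
have g1 := dir _ _ t1p Bt1 g g0; have g2 := dir _ _ t2p Bt2 g g0.
have [t0 Tt0] := T0.
have g3 : dotv g u3 < 0.
  rewrite lt_neqAle; apply/andP; split; last first.
    have := le _ (face_sub Ee.1 Et3); rewrite !dotvE (Bg _ Bb) gerDl.
    by rewrite pmulr_rle0.
  apply/eqP => g3; have gE := Zbasis3_dotv0 zb g1 g2 g3.
  case: (prism_faces_disjoint pf (x := t0)) => //.
  by rewrite BE; split; [exact: TP|rewrite /= -(Bg _ Bb) gE !dotv0l].
pose c := (dotv g u3)^-1 *: g.
have c1 : dotv c u1 = 0 by rewrite dotvZl g1 mulr0.
have c2 : dotv c u2 = 0 by rewrite dotvZl g2 mulr0.
have c3 : dotv c u3 = 1 by rewrite dotvZl mulVf // lt_eqF.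
have gc : g = dotv g u3 *: c by rewrite scalerA divff ?scale1r // lt_eqF.
have cB x : P x -> (B x <-> dotv c x = dotv c b).
  move=> Px; rewrite /c !dotvZl (Bg _ Bb) BE; split=> [[_ /= ->]//|].
  by move=> E'; split=> //; apply: mulfI E'; rewrite invr_eq0 lt_eqF.
have clo x : P x -> dotv c b <= dotv c x.
  by move=> /le; rewrite /c !dotvZl ler_nM2l ?invr_lt0 // (Bg _ Bb).
have [h [k [leT TE]]] := Tf.
have Th x : T x -> dotv h x = k by rewrite TE => -[].
have h0 : lin B `<=` [set v | dotv h v = 0] by rewrite -par => v; apply: lin_const Th.
have h1 := dir _ _ t1p Bt1 h h0; have h2 := dir _ _ t2p Bt2 h h0.
clearbody c.
have hc : h = dotv h u3 *: c.
  apply/eqP; rewrite -subr_eq0; apply/eqP; apply: (Zbasis3_dotv0 zb);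
  by rewrite !dotvE ?h1 ?h2 ?c1 ?c2 ?c3; ring.
have h3 : 0 < dotv h u3.
  rewrite ltNge; apply/negP => h3.
  apply: (prism_faces_disjoint pf Bb); rewrite TE; split.
    by exact: (face_sub (prism_face pf)).
  apply: le_anti; rewrite leT /=; last exact: (face_sub (prism_face pf)).
  by rewrite -(Th _ Tt0) hc !dotvZl ler_wnM2l // clo //; exact: TP.
have cT x : P x -> (T x <-> dotv c x = dotv c t0).
  move=> Px; have hE y : dotv h y = dotv h u3 * dotv c y by rewrite {1}hc dotvZl.
  rewrite TE; split=> [[_ /= E']|E'].
    by apply: (mulfI (negbT (gt_eqF h3))); rewrite -!hE E' Th.
  by split=> //=; rewrite (hE x) E' -hE Th.
exists c, (dotv c b), (dotv c t0), u1, u2, u3; split=> //; split.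
- move=> z zi; have [_ _ _ _ gen] := zb; have [a1 [a2 [a3 [_ _ a3i ->]]]] := gen z zi.
  by rewrite !dotvE c1 c2 c3 !mulr0 !add0r mulr1.
- move=> x Px; rewrite clo //=.
  by have := leT _ Px; rewrite -(Th _ Tt0) hc !dotvZl ler_pM2l.
- rewrite lt_neqAle clo ?andbT; last exact: TP.
  apply/eqP => bt; apply: (prism_faces_disjoint pf Bb); apply/cT => //.
  by exact: (face_sub (prism_face pf)).
- move=> x; split=> [Bx|[Px cx]]; last exact/cB.
  by have Px := face_sub (prism_face pf) Bx; split=> //; exact/cB.
- move=> x; split=> [Tx|[Px cx]]; last exact/cT.
  by have Px := TP _ Tx; split=> //; exact/cT.
Qed.

End VerticalEdges.

(** * Exposed faces containing an edge from bottom to top *)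

Section Support.
Variable R : realType.
Implicit Types (V : seq 'rV[R]_3) (a g u b x y : 'rV[R]_3).

(** The normal cone of the [g1]-face of [P'] is also that of some face [H] of [P]. It contains [g1],
    so [H] is in the [g1]-face and hence in the [g2]-face of [P]; then [g2] is in the cone too. *)
Lemma normal_fan_argmax n (P P' : set 'rV[R]_n) (g1 g2 : 'rV[R]_n) :
  normal_fan P = normal_fan P' ->
  argmax P g1 `<=` argmax P g2 -> argmax P' g1 `<=` argmax P' g2.
Proof.
move=> fan sub x x1.
have : normal_fan P' (normal_cone P' (argmax P' g1)).
  exists (argmax P' g1); split; first exact: argmax_is_face x1.
  by split=> //; exists x.
rewrite -fan => -[H [Hf [[h Hh] NE]]].
have : normal_cone P H g1 by rewrite -NE => y z [Py ymax]; exact: ymax.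
move=> g1H; have HP := face_sub Hf.
have : normal_cone P H g2.
  move=> y z Hy Pz; have [_] : argmax P g2 y; last exact.
  by apply: sub; split; [exact: HP|move=> w; exact: g1H].
by rewrite -NE => g2x; split; [exact: x1.1|move=> y; exact: g2x].
Qed.

(* [b] starts an edge of [conv V] of direction [u] that runs from the lowest to
   the highest level of [c] and lies in the face exposed by [g]. *)
Definition vertical_support V c (lo hi : R) g u b :=
  [/\ b \in V, dotv c b = lo, argmax (conv V) g b &
    exists y, [/\ y \in V, argmax (conv V) g y & y - b = (hi - lo) *: u]].

Lemma supporting_vertical_edge V B T c lo hi u0 a :
  lattice_polytope V -> smooth3 (conv V) ->
  prism_faces (conv V) B T -> prism_faces (conv V) T B ->
  (forall F, is_face (conv V) F -> F !=set0 -> (F `&` B) !=set0 \/ (F `&` T) !=set0) ->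
  height_functional (conv V) B T c lo hi -> integral u0 -> dotv c u0 = 1 ->
  exists (r : R) u b y E, let g := a + r *: c in
    [/\ integral u, dotv c u = 1, vertical_support V c lo hi g u b &
      y - b = (hi - lo) *: u] /\
    [/\ is_edge (conv V) E, E b, E y, argmax (conv V) g y & E `<=` argmax (conv V) g] /\
    [/\ is_vertex (conv V) b, is_vertex (conv V) y, B b & T y].
Proof.
move=> Vi sm pBT pTB meets [cint crange lohi cB cT] u0i cu0.
have Bf := prism_face pBT; have Tf := prism_face pTB.
have [b0 Bb0] := prism_face_nonempty pBT; have [t0 Tt0] := prism_face_nonempty pTB.
have [b1 [b1V Bb1 _]] := vertex_in_face Bf Bb0.
have [t1 [t1V Tt1 _]] := vertex_in_face Tf Tt0.
have maxF (F : set 'rV[R]_3) v : v \in V -> F v -> exists2 w, w \in V /\ F w &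
    forall w', w' \in V -> F w' -> dotv a w' <= dotv a w.
  move=> vV Fv; have : v \in [seq x <- V | `[< F x >]].
    by rewrite mem_filter vV andbT; apply/asboolP.
  move=> /(seq_max (dotv a))[w]; rewrite mem_filter => /andP[/asboolP Fw wV] wmax.
  exists w => // w' w'V Fw'; apply: wmax; rewrite mem_filter w'V andbT.
  exact/asboolP.
have [bm [bmV Bbm] bmax] := maxF _ _ b1V Bb1.
have [tm [tmV Ttm] tmax] := maxF _ _ t1V Tt1.
have d0 : hi - lo != 0 by rewrite subr_eq0 gt_eqF.
(* The multiple for which [a + r *: c] has the same maximum on [B] as on [T]. Every vertex is in one
   of these, so this is the maximum on the whole polytope. *)
pose r := (dotv a bm - dotv a tm) / (hi - lo).
pose g := a + r *: c.
have gE x : dotv g x = dotv a x + r * dotv c x by rewrite !dotvE.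
have lvB x : B x -> dotv c x = lo by move=> /cB[].
have lvT x : T x -> dotv c x = hi by move=> /cT[].
have gbt : dotv g bm = dotv g tm.
  have : r * (hi - lo) = dotv a bm - dotv a tm by rewrite divfK.
  by rewrite !gE (lvB _ Bbm) (lvT _ Ttm); clear; lra.
have [w wV gw] := argmax_conv_nonempty g b1V.
have [v [vV gv vv]] := vertex_in_face (argmax_is_face gw) gw.
have le_bm : dotv g v <= dotv g bm.
  have [|[x [/= -> Bv]]|[x [/= -> Tv]]] := meets _ vv; first by exists v.
    by rewrite !gE (lvB _ Bv) (lvB _ Bbm) lerD2r bmax.
  by rewrite gbt !gE (lvT _ Tv) (lvT _ Ttm) lerD2r tmax.
have Fb : argmax (conv V) g bm.
  by split; [exact: conv_mem|move=> y /gv.2 /le_trans; apply].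
have Ft : argmax (conv V) g tm.
  by split; [exact: conv_mem|move=> y; rewrite -gbt; exact: Fb.2].
have Ff := argmax_is_face Fb.
have [b [bV [Fbb Bb] bv]] := vertex_in_face (faceI Ff Bf) (conj Fb Bbm).
have [E [u [u1 [u2 [[Ee Eb EB [s s0 Es]] [zb [s1 s1p Bs1] [s2 s2p Bs2]]]]]]] :=
  vertical_edge_exists pBT (prism_face_nonempty pTB) (face_sub Tf) sm bv Bb.
have bsub (G : set 'rV[R]_3) : G b -> [set b] `<=` G by move=> Gb _ ->.
have FB : ~ argmax (conv V) g `<=` B.
  by move=> /(_ _ Ft) Btm; exact: (prism_faces_disjoint pBT Btm Ttm).
have [|y0 Ty0 [Ey0 Fy0]] := prism_face_lift pBT bv _ (bsub B Bb) Ee.1 Ff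
  (bsub E Eb) (bsub _ Fbb) EB FB; first by exists b.
have [y [yV [[Ey Fy] Ty] yv]] := vertex_in_face (faceI (faceI Ee.1 Ff) Tf)
  (conj (conj Ey0 Fy0) Ty0).
have yb : y <> b by move=> yb; apply: (prism_faces_disjoint pBT Bb); rewrite -yb.
have cB0 t v' : 0 < t -> B (b + t *: v') -> dotv c v' = 0.
  move=> t0' /lvB; rewrite dotvDr dotvZr (lvB _ Bb) => E0.
  have /eqP : t * dotv c v' = 0 by clear -E0; lra.
  by rewrite mulf_eq0 gt_eqF //= => /eqP.
have c1 := cB0 _ _ s1p Bs1; have c2 := cB0 _ _ s2p Bs2.
have [_ _ ui _ gen] := zb.
(* The vector [u0] has height 1, which is the product of the integers [k3] and [dotv c u], the
   latter positive. *)
have cu : dotv c u = 1.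
  have [k1 [k2 [k3 [_ _ k3i u0E]]]] := gen _ u0i.
  have k3c : k3 * dotv c u = 1.
    by rewrite -cu0 u0E !dotvE c1 c2 !mulr0 !add0r.
  have cu0' : 0 < dotv c u.
    have /andP[+ _] := crange _ (face_sub Ee.1 Es).
    rewrite !dotvE (lvB _ Bb) lerDl pmulr_rge0 // le_eqVlt => /predU1P[cu|//].
    by move/eqP: k3c; rewrite -cu mulr0 eq_sym oner_eq0.
  have k30 : 0 < k3 by rewrite -(pmulr_lgt0 _ cu0') k3c.
  have k31 := int_gt0_ge1 k3i k30.
  have cu1 := int_gt0_ge1 (cint _ ui) cu0'.
  apply: le_anti; rewrite cu1 andbT -k3c.
  by rewrite ler_peMl // ltW.
have yE : y - b = (hi - lo) *: u.
  have [l lE] := edge_line Ee Eb Ey yb Es.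
  move/addrI: lE => lE; have sl : s = l * (hi - lo).
    have := congr1 (dotv c) lE; rewrite !dotvE cu mulr1 => ->.
    by rewrite (lvT _ Ty) (lvB _ Bb).
  have l0 : l != 0.
    by apply/eqP => l0; move: s0; rewrite sl l0 mul0r ltxx.
  apply: (@scalerI _ _ l) => //; rewrite -lE sl scalerA; congr (_ *: _).
exists r, u, b, y, E; split; first split=> //.
  by split=> //; [exact: lvB|exists y].
split; last by split.
split=> // x Ex; split; first exact: (face_sub Ee.1).
move=> z /Fbb.2; suff -> : dotv g x = dotv g b by [].
have [l ->] := edge_line Ee Eb Ey yb Ex.
by rewrite dotvDr dotvZr dotvBr (argmax_eq Fbb Fy) subrr mulr0 addr0.
Qed.

End Support.

(** * Carrying an edge from bottom to top over to the second polytope *)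

Section Transfer.
Variable R : realType.
Implicit Types (V : seq 'rV[R]_3) (c g u b x y : 'rV[R]_3).

Lemma argmax_add (P : set 'rV[R]_3) g h x : argmax P g x -> argmax P h x ->
  argmax P (g + h) `<=` argmax P g `&` argmax P h.
Proof.
move=> gx hx y [Py ymax]; have := ymax _ gx.1; rewrite !dotvDl => le.
have ge := gx.2 _ Py; have he := hx.2 _ Py.
by split; split=> // z Pz; [have := gx.2 _ Pz|have := hx.2 _ Pz]; lra.
Qed.

Lemma proportional x u : u != 0 ->
  (forall h : 'rV[R]_3, dotv h u = 0 -> dotv h x = 0) -> exists l : R, x = l *: u.
Proof.
move=> u0 hx; have uu : dotv u u != 0.
  by apply: contra_neq u0 => /dotv_eq0.
exists (dotv x u / dotv u u); apply/eqP; rewrite -subr_eq0; apply/eqP/dotv_eq0.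
set h := x - _.
have hu : dotv h u = 0 by rewrite /h dotvBl dotvZl divfK // subrr.
by rewrite {2}/h dotvBr dotvZr hu (hx _ hu) mulr0 subr0.
Qed.

(** If [h] exposes [E] on the first polytope, its face on the second is parallel to [u], and [h + c]
    and [h - c] pick points of it on the extreme levels. If the [g]-face of the first were within
    [E], that of the second would be within this segment, which meets each level once. *)
Lemma vertical_support_transfer V V' c (lo hi lo' hi' : R) g u b y E v0 :
  normal_fan (conv V) = normal_fan (conv V') ->
  is_edge (conv V) E -> E b -> E y -> y - b = (hi - lo) *: u -> lo < hi ->
  dotv c u = 1 -> dotv c b = lo -> dotv c y = hi ->
  (forall x, conv V x -> lo <= dotv c x <= hi) ->
  E `<=` argmax (conv V) g -> v0 \in V' ->
  (forall x, argmax (conv V') c x -> dotv c x = hi') ->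
  (forall x, argmax (conv V') (- c) x -> dotv c x = lo') ->
  (exists b', vertical_support V' c lo' hi' g u b') /\
  (forall x1 x2, argmax (conv V') g x1 -> argmax (conv V') g x2 -> x1 <> x2 ->
     dotv c x1 = dotv c x2 -> ~ argmax (conv V) g `<=` E).
Proof.
move=> fan Ee Eb Ey yE lohi cu cb cy crange Eg v0V' hi'P lo'P.
have [h Eh] := face_argmax Ee.1 Eb.
have d0 : hi - lo != 0 by rewrite subr_eq0 gt_eqF.
have u0 : u != 0.
  by apply/eqP => u0; move/eqP: cu; rewrite u0 dotv0r eq_sym oner_eq0.
have yb : y <> b.
  by move=> yb; move: lohi; rewrite -cb -cy yb ltxx.
have order := normal_fan_argmax fan.
have Eg' : argmax (conv V') h `<=` argmax (conv V') g by apply: order; rewrite -Eh.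
(* A functional [k] vanishing on [u] is constant on [E], so adding a little of it to [h] still
   exposes [E]; by transfer of inclusions, [k] is constant on the [h]-face of the second
   polytope. *)
have par x1 x2 : argmax (conv V') h x1 -> argmax (conv V') h x2 ->
    exists l : R, x1 - x2 = l *: u.
  move=> x1h x2h; apply: proportional => // k ku.
  have kE x : E x -> dotv k x = dotv k b.
    move=> Ex; have [l ->] := edge_line Ee Eb Ey yb Ex.
    by rewrite yE !dotvE ku !mulr0 addr0.
  have hb : argmax (conv V) h b by rewrite -Eh.
  have [|e e0 eP] := argmax_perturb (h := k) hb.
    by rewrite -Eh => z /kE ->.
  have sub : argmax (conv V) h `<=` argmax (conv V) (h + e *: k).
    by move=> z hz; apply/eP; split=> //; apply: kE; rewrite Eh.
  have hek := order _ _ sub.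
  have := argmax_eq (hek _ x1h) (hek _ x2h).
  rewrite !dotvDl !dotvZl (argmax_eq x1h x2h) => /addrI/mulfI.
  by rewrite dotvBr => -> //; [rewrite subrr|rewrite gt_eqF].
have cyV : argmax (conv V) c y.
  split; first exact: (face_sub Ee.1).
  by move=> z /crange/andP[_]; rewrite cy.
have cbV : argmax (conv V) (- c) b.
  split; first exact: (face_sub Ee.1).
  by move=> z /crange/andP[+ _]; rewrite !dotvNl lerN2 cb.
have hyV : argmax (conv V) h y by rewrite -Eh.
have hbV : argmax (conv V) h b by rewrite -Eh.
have top : argmax (conv V') (h + c) `<=` argmax (conv V') h `&` argmax (conv V') c.
  move=> z z1; split; apply: order z1 => x x1;
  by have [] := argmax_add hyV cyV x1.
have bot : argmax (conv V') (h - c) `<=` argmax (conv V') h `&` argmax (conv V') (- c).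
  move=> z z1; split; apply: order z1 => x x1;
  by have [] := argmax_add hbV cbV x1.
split.
  have [y' y'V' /top[hy' cy']] := argmax_conv_nonempty (h + c) v0V'.
  have [b' b'V' /bot[hb' cb']] := argmax_conv_nonempty (h - c) v0V'.
  have [l lE] := par _ _ hy' hb'.
  have lc : l = hi' - lo'.
    have := congr1 (dotv c) lE; rewrite dotvBr dotvZr cu mulr1 => <-.
    by rewrite (hi'P _ cy') (lo'P _ cb').
  exists b'; split=> //; [exact: lo'P|exact: Eg'|].
  by exists y'; rewrite -lc; split=> //; exact: Eg'.
move=> x1 x2 gx1 gx2 x12 cx12 gE.
have sub : argmax (conv V') g `<=` argmax (conv V') h by apply: order; rewrite -Eh.
have [l lE] := par _ _ (sub _ gx1) (sub _ gx2).
have l0 : l = 0.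
  by have := congr1 (dotv c) lE; rewrite dotvBr dotvZr cu mulr1 cx12 subrr.
by apply: x12; apply/eqP; rewrite -subr_eq0 lE l0 scale0r.
Qed.

(** If the exposed face met [B] only in [b], [prism_face_lift_min] would put it inside [E]; likewise
    for [T] and [y]. Below the top, the segments joining two of its points in [B] to [y] cross level
    [s] in different points. *)
Lemma level_two_points V B T c (lo hi : R) g b y E s :
  prism_faces (conv V) B T -> prism_faces (conv V) T B ->
  height_functional (conv V) B T c lo hi ->
  is_edge (conv V) E -> E b -> E y -> B b -> T y ->
  is_vertex (conv V) b -> is_vertex (conv V) y ->
  argmax (conv V) g b -> argmax (conv V) g y ->
  ~ argmax (conv V) g `<=` E -> lo <= s <= hi ->
  exists q1 q2, [/\ q1 <> q2, argmax (conv V) g q1 /\ argmax (conv V) g q2,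
    dotv c q1 = s & dotv c q2 = s].
Proof.
move=> pBT pTB [_ crange lohi cB cT] Ee Eb Ey Bb Ty bv yv gb gy gE /andP[los shi].
have Ff := argmax_is_face gb.
have other P Q v : prism_faces (conv V) P Q -> is_vertex (conv V) v -> P v ->
    E v -> argmax (conv V) g v -> ~ E `<=` P -> ~ argmax (conv V) g `<=` P ->
    exists2 w, w <> v & argmax (conv V) g w /\ P w.
  move=> pf vv Pv Ev gv EP gP; apply: contrapT => h; apply: gE.
  have vsub (G : set 'rV[R]_3) : G v -> [set v] `<=` G by move=> Gv _ ->.
  apply: (prism_face_lift_min pf vv _ (vsub _ Pv) Ee.1 Ff (vsub _ Ev) (vsub _ gv) EP gP).
    by exists v.
  by move=> w [gw Pw]; apply: contrapT => wv; apply: h; exists w.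
have disj := prism_faces_disjoint pBT.
have [sE|s_hi] := eqVneq s hi.
  have [||w wy [gw Tw]] := other T B y pTB yv Ty Ey gy.
  - by move=> /(_ _ Eb) Tb; exact: disj Tb.
  - by move=> /(_ _ gb) Tb; exact: disj Tb.
  by exists w, y; split=> //; rewrite sE; [move/cT: Tw => []|move/cT: Ty => []].
have {shi} shi : s < hi by rewrite lt_neqAle s_hi.
have [||w wb [gw Bw]] := other B T b pBT bv Bb Eb gb.
- by move=> /(_ _ Ey) By; exact: disj By Ty.
- by move=> /(_ _ gy) By; exact: disj By Ty.
have d0 : 0 < hi - lo by rewrite subr_gt0.
pose l := (s - lo) / (hi - lo).
have lE : l * (hi - lo) = s - lo by rewrite divfK // gt_eqF.
have l01 : 0 <= l < 1.
  apply/andP; split; first by rewrite divr_ge0 // subr_ge0 // ltW.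
  by rewrite ltr_pdivrMr // mul1r ltrD2r.
have l01' : 0 <= l <= 1 by case/andP: l01 => -> /ltW.
have pt v : argmax (conv V) g v -> B v ->
    argmax (conv V) g (v + l *: (y - v)) /\ dotv c (v + l *: (y - v)) = s.
  move=> gv Bv; split; last first.
    have [_ cv] := (cB v).1 Bv; have [_ cy] := (cT y).1 Ty.
    by rewrite !dotvE cv cy; have := lE; clear; lra.
  split; first by apply: conv_convex => //; [exact: gv.1|exact: gy.1].
  move=> z /gv.2; rewrite dotvDr dotvZr dotvBr (argmax_eq gv gy).
  by rewrite subrr mulr0 addr0.
have [gw' cw'] := pt w gw Bw; have [gb' cb'] := pt b gb Bb.
exists (w + l *: (y - w)), (b + l *: (y - b)); split=> // E0.
apply: wb; apply: (@scalerI _ _ (1 - l)).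
  by rewrite subr_eq0 gt_eqF //; case/andP: l01.
have wE v : v + l *: (y - v) = (1 - l) *: v + l *: y.
  by rewrite scalerBr scalerBl scale1r [LHS]addrA addrAC.
by move: E0; rewrite !wE => /addIr.
Qed.

End Transfer.

(** * Slices *)

Section Slices.
Variable R : realType.
Implicit Types (V : seq 'rV[R]_3) (c g u b x y : 'rV[R]_3).

(* An edge of [conv V] from the level [lo] of [c] to its level [hi] meets the
   level [s] in one of the points filtered here. *)
Definition slice V c (lo hi s : R) : seq 'rV[R]_3 :=
  [seq w <- [seq b + ((s - lo) / (hi - lo)) *: (y - b) | b <- V, y <- V] |
    `[< [/\ integral w, conv V w & dotv c w = s] >]].

Lemma slice_mem V c lo hi s w : w \in slice V c lo hi s ->
  [/\ integral w, conv V w & dotv c w = s].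
Proof. by rewrite mem_filter => /andP[/asboolP]. Qed.

Lemma slice_sub V c lo hi s x : conv (slice V c lo hi s) x ->
  conv V x /\ dotv c x = s.
Proof.
move: x; apply: (@conv_min _ _ _ [set x | conv V x /\ dotv c x = s]) => /=.
  move=> x y t t01 [Vx cx] [Vy cy]; split; first exact: conv_convex.
  by rewrite !dotvE cx cy subrr mulr0 addr0.
by move=> w /slice_mem[].
Qed.

Lemma vertical_support_level V c lo hi g u b s : lattice_polytope V ->
  integral u -> dotv c u = 1 -> vertical_support V c lo hi g u b ->
  lo \is a Num.int -> s \is a Num.int -> lo <= s <= hi ->
  b + (s - lo) *: u \in slice V c lo hi s /\ argmax (conv V) g (b + (s - lo) *: u).
Proof.
move=> Vi ui cu [bV cb gb [y [yV gy yE]]] loi si /andP[los shi].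
pose t := (s - lo) / (hi - lo).
have wE : b + (s - lo) *: u = b + t *: (y - b).
  rewrite yE; congr (_ + _); rewrite scalerA.
  have [d0|d0] := eqVneq (hi - lo) 0; last by rewrite divfK.
  have -> : s - lo = 0 by clear -d0 los shi; lra.
  by rewrite d0 mulr0.
have t01 : 0 <= t <= 1.
  have : 0 <= hi - lo by clear -los shi; lra.
  rewrite le_eqVlt => /predU1P[d0|d0].
    by rewrite /t -d0 invr0 mulr0 lexx ler01.
  apply/andP; split; first by rewrite divr_ge0 ?subr_ge0 // ltW // -subr_gt0.
  by rewrite ler_pdivrMr // mul1r lerD2r.
have Vw : conv V (b + (s - lo) *: u).
  by rewrite wE; apply: conv_convex => //; exact: conv_mem.
split.
  rewrite mem_filter; apply/andP; split; last by rewrite wE; exact: allpairs_f.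
  apply/asboolP; split=> //.
    by move=> i; rewrite !mxE rpredD ?rpredM ?rpredB //; exact: Vi.
  by rewrite dotvDr dotvZr cb cu mulr1 subrKC.
split=> // z /gb.2; suff -> : dotv g (b + (s - lo) *: u) = dotv g b by [].
by rewrite wE dotvDr dotvZr dotvBr (argmax_eq gb gy) subrr mulr0 addr0.
Qed.

Definition common_support V V' c (lo hi lo' hi' : R) a r u b b' :=
  [/\ integral u, dotv c u = 1,
    vertical_support V c lo hi (a + r *: c) u b &
    vertical_support V' c lo' hi' (a + r *: c) u b'].

Lemma level_le V a r c x y : argmax (conv V) (a + r *: c) y -> conv V x ->
  dotv c x = dotv c y -> dotv a x <= dotv a y.
Proof. by move=> gy /gy.2 + cxy; rewrite !dotvE cxy lerD2r. Qed.

(** A functional separating a point of the level from the slice would contradict the vertical edge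
    supporting it, whose point on this level is in the slice. *)
Lemma slice_convE V c lo hi s x : lattice_polytope V ->
  (forall a, exists r u b, [/\ integral u, dotv c u = 1 &
    vertical_support V c lo hi (a + r *: c) u b]) ->
  lo \is a Num.int -> s \is a Num.int -> lo <= s <= hi ->
  conv V x -> dotv c x = s -> conv (slice V c lo hi s) x.
Proof.
move=> Vi sup loi si s_in Vx cx; apply: contrapT => /conv_separation[a sep].
have [r [u [b [ui cu vs]]]] := sup a.
have [wS gw] := vertical_support_level Vi ui cu vs loi si s_in.
have := sep _ wS; rewrite ltNge => /negP; apply.
apply: (level_le gw Vx).
by have [_ _ ->] := slice_mem wS.
Qed.

Lemma sliced_idp V V' c lo hi lo' hi' u1 u2 u3 :
  lattice_polytope V -> lattice_polytope V' ->
  (forall z, integral z -> dotv c z \is a Num.int) ->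
  (forall x, conv V x -> lo <= dotv c x <= hi) ->
  (forall x, conv V' x -> lo' <= dotv c x <= hi') ->
  lo \is a Num.int -> lo' \is a Num.int -> hi' \is a Num.int ->
  Zbasis3 u1 u2 u3 -> dotv c u1 = 0 -> dotv c u2 = 0 -> dotv c u3 = 1 ->
  (forall a, exists r u b b', common_support V V' c lo hi lo' hi' a r u b b' /\
    forall x1 x2, argmax (conv V') (a + r *: c) x1 ->
      argmax (conv V') (a + r *: c) x2 -> x1 <> x2 -> dotv c x1 = dotv c x2 ->
    forall s, lo <= s <= hi -> exists q1 q2, [/\ q1 <> q2,
      argmax (conv V) (a + r *: c) q1 /\ argmax (conv V) (a + r *: c) q2,
      dotv c q1 = s & dotv c q2 = s]) ->
  IDP_pair (conv V) (conv V').
Proof.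
move=> Vi V'i cint crange crange' loi lo'i hi'i zb c1 c2 c3 sup z zi
  [x [y [Vx [V'y zE]]]].
(* Rounding cannot leave the height ranges, since [lo] and [hi'] are integers. *)
pose s : R := (Num.floor (dotv c x))%:~R.
pose t := dotv c z - s.
have si : s \is a Num.int by rewrite intr_int.
have ti : t \is a Num.int by rewrite rpredB // cint.
have sx : s <= dotv c x by rewrite /s floor_le_tmp.
have xs : dotv c x < s + 1 by rewrite /s -[1]/(1%:~R) -intrD floorD1_gt.
have czE : dotv c z = dotv c x + dotv c y by rewrite zE dotvDr.
have /andP[lox xhi] := crange _ Vx; have /andP[loy yhi] := crange' _ V'y.
have s_in : lo <= s <= hi.
  rewrite (le_trans sx xhi) andbT.
  have s1i : s + 1 \is a Num.int by rewrite rpredD ?rpred1.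
  by have := int_lt_leB1 loi s1i (le_lt_trans lox xs); rewrite addrK.
have t_in : lo' <= t <= hi'.
  apply/andP; split; first by rewrite /t czE; clear -loy sx; lra.
  have : t < hi' + 1 by rewrite /t czE; clear -yhi xs; lra.
  have hi'1 : hi' + 1 \is a Num.int by rewrite rpredD ?rpred1.
  by move/(int_lt_leB1 ti hi'1); rewrite addrK.
pose S := slice V c lo hi s; pose S' := slice V' c lo' hi' t.
have Si : lattice_polytope S by move=> w /slice_mem[].
have S'i : lattice_polytope S' by move=> w /slice_mem[].
(* A functional [a] separating [z] is beaten by the two support points: [a + r *: c] is maximal
   there, and the [c]-terms cancel because [s + t] is the height of [z]. *)
have [x1 [y1 [Sx1 S'y1 zE1]]] : exists x1 y1, [/\ conv S x1, conv S' y1 & z = x1 + y1].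
  apply: conv_sum_inv; apply: contrapT => /conv_separation[a sep].
  have [r [u [b [b' [[ui cu vs vs'] _]]]]] := sup a.
  have [wS gw] := vertical_support_level Vi ui cu vs loi si s_in.
  have [wS' gw'] := vertical_support_level V'i ui cu vs' lo'i ti t_in.
  have := sep _ (allpairs_f (fun p q => p + q) wS wS').
  rewrite ltNge => /negP; apply.
  have := gw.2 _ Vx; have := gw'.2 _ V'y.
  have [_ _ cw] := slice_mem wS; have [_ _ cw'] := slice_mem wS'.
  rewrite !(dotvDl, dotvZl) cw cw' zE !(dotvDr a) => h h'.
  have : r * s + r * t = r * dotv c x + r * dotv c y.
    by rewrite -!mulrDr -czE /t subrKC.
  by move: h h'; clear; lra.
(* The functionals dual to [u1] and [u2]; the one dual to [u3] is [c]. They identify each integral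
   level with the plane lattice. *)
have [p [p1i p2i pE]] : exists p : 'rV[R]_3 * 'rV[R]_3, [/\ integral p.1, integral p.2 &
    forall x, x = dotv p.1 x *: u1 + dotv p.2 x *: u2 + dotv c x *: u3].
  have [_ _ _ _ gen] := zb.
  have /choice[k kP] (i : 'I_3) : exists k : R * R * R, [/\ k.1.1 \is a Num.int,
      k.1.2 \is a Num.int & delta_mx 0 i = k.1.1 *: u1 + k.1.2 *: u2 + k.2 *: u3].
    have [j|k1 [k2 [k3 [? ? ? dE]]]] := gen (delta_mx 0 i).
      by rewrite mxE rpred_nat.
    by exists (k1, k2, k3).
  exists (\row_i (k i).1.1, \row_i (k i).1.2); split=> [i|i|w].
  - by rewrite mxE; case: (kP i).
  - by rewrite mxE; case: (kP i).
  have wE : w = dotv (\row_i (k i).1.1) w *: u1 + dotv (\row_i (k i).1.2) w *: u2 +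
      dotv (\row_i (k i).2) w *: u3.
    rewrite [LHS]row_sum_delta /dotv !scaler_suml -!big_split; apply: eq_bigr => i _.
    have [_ _ ->] := kP i; rewrite !mxE !scalerDr !scalerA.
    by rewrite !(mulrC (w 0 i)).
  rewrite [LHS]wE; congr (_ + _ *: _).
  by rewrite [in RHS]wE !dotvE c1 c2 c3 !mulr0 !add0r mulr1.
pose proj x := pt (dotv p.1 x) (dotv p.2 x).
pose lift (v : 'rV[R]_2) l := v 0 0 *: u1 + v 0 1 *: u2 + l *: u3.
have projK w : w = lift (proj w) (dotv c w) by rewrite /lift /proj pt0 pt1 -pE.
have projA v w l : proj (v + l *: (w - v)) = proj v + l *: (proj w - proj v).
  by apply: eq_pt; rewrite !mxE /= !dotvE.
have int_dot (v w : 'rV[R]_3) : integral v -> integral w -> dotv v w \is a Num.int.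
  by move=> vi wi; apply: rpred_sum => i _; rewrite rpredM.
have proji w : integral w -> integral (proj w).
  by move=> wi; apply/integral2; rewrite /proj pt0 pt1; split; exact: int_dot.
have lifti v l : integral v -> l \is a Num.int -> integral (lift v l).
  have [u1i u2i u3i _ _] := zb.
  by move=> vi li i; rewrite !mxE !rpredD ?rpredM.
have projD v w : proj (v + w) = proj v + proj w.
  by apply: eq_pt; rewrite !mxE /= !dotvE.
have latticeS W : lattice_polytope W -> lattice_polytope (map proj W).
  by move=> Wi v /mapP[w /Wi wi ->]; exact: proji.
(* Two maximizers in the second slice are points of equal height in an exposed face of the second
   polytope, which yields two such points on level [s] of the first. *)
have ref : two_maximizers_refine (map proj S) (map proj S').
  move=> a [_ [_ [[/mapP[v vS' ->] vmax] [/mapP[w wS' ->] wmax] vw]]].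
  pose a3 := a 0 0 *: p.1 + a 0 1 *: p.2.
  have a3E q : dotv a (proj q) = dotv a3 q by rewrite dotv2 /proj pt0 pt1 !dotvE.
  clearbody a3.
  have [r [u [b [b' [[ui cu vs vs'] two]]]]] := sup a3.
  have [pS' gp'] := vertical_support_level V'i ui cu vs' lo'i ti t_in.
  have [pS gp] := vertical_support_level Vi ui cu vs loi si s_in.
  have [_ _ cp'] := slice_mem pS'; have [_ _ cp] := slice_mem pS.
  have max' q : q \in S' -> (forall q', q' \in map proj S' ->
      dotv a q' <= dotv a (proj q)) -> argmax (conv V') (a3 + r *: c) q.
    move=> qS' qmax; have [_ Vq cq] := slice_mem qS'; split=> // q' /gp'.2.
    move/le_trans; apply; rewrite !(dotvDl, dotvZl) cp' cq lerD2r -!a3E.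
    by apply: qmax; exact: map_f.
  have [_ _ cv] := slice_mem vS'; have [_ _ cw] := slice_mem wS'.
  have [||q1 [q2 [q12 [gq1 gq2] cq1 cq2]]] :=
    two v w (max' v vS' vmax) (max' w wS' wmax) _ _ s s_in.
  - by move=> E; apply: vw; rewrite E.
  - by rewrite cv cw.
  have conv_S q : argmax (conv V) (a3 + r *: c) q -> dotv c q = s -> conv S q.
    move=> gq cq; apply: slice_convE => //; last exact: gq.1.
    by move=> a'; have [r' [u' [b1 [b1' [[? ? ? _] _]]]]] := sup a'; exists r', u', b1.
  have S_max q : argmax (conv V) (a3 + r *: c) q -> dotv c q = s ->
      forall q', q' \in S -> dotv a3 q' <= dotv a3 q.
    move=> gq cq q' /slice_mem[_ Vq' cq'].
    by apply: level_le gq Vq' _; rewrite cq cq'.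
  have [v' [w' [[v'S v'max] [w'S w'max] v'w']]] := two_maximizers (conv_S _ gq1 cq1)
    (conv_S _ gq2 cq2) q12 (S_max _ gq1 cq1) (S_max _ gq2 cq2).
  have up q : q \in S -> (forall q', q' \in S -> dotv a3 q' <= dotv a3 q) ->
      maximizer a (map proj S) (proj q).
    move=> qS qmax; split; first exact: map_f.
    by move=> _ /mapP[q' q'S ->]; rewrite !a3E; exact: qmax.
  exists (proj v'), (proj w'); split; [exact: up|exact: up|].
  move=> E; apply: v'w'; rewrite (projK v') (projK w') E.
  by have [_ _ ->] := slice_mem v'S; have [_ _ ->] := slice_mem w'S.
have [|x2 [y2 [x2i y2i Sx2 S'y2 xyE]]] := lattice_polygons_idp (latticeS _ Si)
  (latticeS _ S'i) ref (proji _ zi).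
  exists (proj x1), (proj y1); split; first exact: conv_map.
  by split; [exact: conv_map|rewrite zE1 projD].
have [x3 Sx3 x3E] := conv_map_inv projA Sx2.
have [y3 S'y3 y3E] := conv_map_inv projA S'y2.
have [Vx3 cx3] := slice_sub Sx3; have [V'y3 cy3] := slice_sub S'y3.
exists x3, y3; split=> //.
- by rewrite (projK x3) -x3E cx3; exact: lifti.
- by rewrite (projK y3) -y3E cy3; exact: lifti.
rewrite (projK z) xyE (_ : dotv c z = dotv c (x3 + y3)).
  by rewrite x3E y3E -projD -projK.
by rewrite dotvDr cx3 cy3 /t subrKC.
Qed.

End Slices.

Theorem theorem4p5 (R : realType) (V V' : seq 'rV[R]_3) :
  lattice_polytope V -> lattice_polytope V' ->
  has_dim (conv V) 3 -> has_dim (conv V') 3 ->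
  smooth3 (conv V) -> smooth3 (conv V') ->
  prismatoid3 (conv V) -> prismatoid3 (conv V') ->
  minkowski_equiv (conv V) (conv V') ->
  IDP_pair (conv V) (conv V').
Proof.
move=> Vi V'i _ [[v0 [_ [V'v0 _]]] _] sm _ prP _ fan.
have [B [T [pBT pTB par meets]]] := prismatoid_faces prP.
have Bf := prism_face pBT; have Tf := prism_face pTB.
have [b0 Bb0] := prism_face_nonempty pBT; have [t0 Tt0] := prism_face_nonempty pTB.
have [b [bV Bb bv]] := vertex_in_face Bf Bb0.
have [tt [ttV Ttt _]] := vertex_in_face Tf Tt0.
have [c [lo [hi [u1 [u2 [u3 [hf [zb c1 c2 c3]]]]]]]] :=
  height_exists pBT (prism_face_nonempty pTB) Tf sm par bv Bb.
have [cint crange lohi cB cT] := hf.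
have [w wV'] := conv_nonempty V'v0.
(* The extreme heights of the second polytope are attained at generators, so they are integers. *)
have [y1 y1V' y1max] := argmax_conv_nonempty c wV'.
have [y2 y2V' y2max] := argmax_conv_nonempty (- c) wV'.
have y2min x : conv V' x -> dotv c y2 <= dotv c x.
  by move=> /y2max.2; rewrite !dotvNl lerN2.
have y2E x : argmax (conv V') (- c) x -> dotv c x = dotv c y2.
  by move=> /argmax_eq/(_ y2max); rewrite !dotvNl => /oppr_inj.
have [_ _ u3i _ _] := zb.
apply: (@sliced_idp _ V V' c lo hi (dotv c y2) (dotv c y1) u1 u2 u3) => //.
- by move=> x V'x; rewrite y2min //=; exact: y1max.2.
- by have [_ <-] := (cB b).1 Bb; apply: cint; exact: Vi.
- by apply: cint; exact: V'i.
- by apply: cint; exact: V'i.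
move=> a.
have [r [u [b1 [y [E [[ui cu vs yE] [[Ee Eb Ey gy Eg] [bv1 yv Bb1 Ty]]]]]]]] :=
  supporting_vertical_edge a Vi sm pBT pTB meets hf u3i c3.
have [_ cb _ _] := vs; have [_ cy] := (cT y).1 Ty.
have [[b' vs'] two] := vertical_support_transfer fan Ee Eb Ey yE lohi cu cb cy
  crange Eg wV' (fun x xm => argmax_eq xm y1max) y2E.
exists r, u, b1, b'; split; first by split.
move=> x1 x2 g1 g2 x12 cx s s_in.
exact: level_two_points pBT pTB hf Ee Eb Ey Bb1 Ty bv1 yv (Eg _ Eb) gy
  (two _ _ g1 g2 x12 cx) s_in.
Qed.
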